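(* Let $\Bbbk$ be an algebraically closed field, and let $\mathcal{C}$ and $\mathcal{C}'$ be two non-semisimple finite tensor categories over $\Bbbk$ having no projective simple objects and such that $\operatorname{FPdim}(\mathcal{C})=\operatorname{FPdim}(\mathcal{C}')$. Suppose $F:\mathcal{C}\to\mathcal{C}'$ is an exact $\Bbbk$-linear monoidal functor inducing a stable equivalence $\underline{F}:\underline{\mathcal{C}}\to\underline{\mathcal{C}'}$. Then $F$ is a tensor equivalence.
   Context: A finite tensor category over $\Bbbk$ is a finite $\Bbbk$-linear abelian category (i.e. equivalent, as a $\Bbbk$-linear abelian category, to the category of finite-dimensional modules over a finite-dimensional $\Bbbk$-algebra) which is rigid monoidal with $\Bbbk$-bilinear tensor product and with $\operatorname{End}(\mathbf{1})=\Bbbk$ for the unit object $\mathbf{1}$. Monoidal functors are strong: they come with coherent natural isomorphisms $F(X)\otimes F(Y)\cong F(X\otimes Y)$ and $F(\mathbf{1})\cong\mathbf{1}$. Frobenius-Perron dimension: for an object $X$ of a finite tensor category $\mathcal{C}$, $\operatorname{FPdim}(X)$ is the largest positive eigenvalue of the matrix of left (or right) multiplication by $X$ on the Grothendieck ring in the basis of simple classes; $\operatorname{FPdim}$ is the unique additive (on short exact sequences) and multiplicative (for $\otimes$) function taking positive values on all simple objects. If $\{L_i\}_{i\in I}$ is a set of representatives of the isomorphism classes of simple objects and $P_i$ is the projective cover of $L_i$, then $\operatorname{FPdim}(\mathcal{C}):=\sum_{i\in I}\operatorname{FPdim}(L_i)\operatorname{FPdim}(P_i)$. The stable category $\underline{\mathcal{C}}$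 of a $\Bbbk$-linear abelian category $\mathcal{C}$ has the same objects as $\mathcal{C}$, and morphism spaces $\underline{\operatorname{Hom}}_{\mathcal{C}}(X,Y)=\operatorname{Hom}_{\mathcal{C}}(X,Y)/\mathcal{P}(X,Y)$, where $\mathcal{P}(X,Y)$ is the subspace of morphisms factoring through a projective object. The class of $f$ is written $\underline{f}$. If a $\Bbbk$-linear functor $F:\mathcal{C}\to\mathcal{C}'$ maps projective objects to projective objects, it induces $\underline{F}:\underline{\mathcal{C}}\to\underline{\mathcal{C}'}$, $X\mapsto F(X)$, $\underline{f}\mapsto\underline{F(f)}$. ''$F$ induces a stable equivalence'' means that $F$ maps projectives to projectives and $\underline{F}$ is an equivalence of ($\Bbbk$-linear) categories. A tensor equivalence is a $\Bbbk$-linear monoidal functor that is an equivalence of categories. *)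

(* Defs.v *)
From HB Require Import structures.
From mathcomp Require Import all_boot all_order all_algebra all_field.
From mathcomp Require Import ring_quotient generic_quotient.
From mathcomp Require Import boolp classical_sets reals.

Set Implicit Arguments.
Unset Strict Implicit.
Unset Printing Implicit Defensive.

Import GRing.Theory.
Local Open Scope ring_scope.
Local Obligation Tactic := idtac.

Reserved Notation "g \oc f" (at level 40, left associativity).
Reserved Notation "X \ox Y" (at level 40, left associativity).
Reserved Notation "f \oxm g" (at level 40, left associativity).

Record kcat (k : fieldType) := KCat {
  ob :> Type;
  hom : ob -> ob -> lmodType k;
  idm : forall X, hom X X;
  comp : forall X Y Z, hom Y Z -> hom X Y -> hom X Z;
  comp1m : forall X Y (f : hom X Y), comp (idm Y) f = f;
  compm1 : forall X Y (f : hom X Y), comp f (idm X) = f;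
  compA : forall X Y Z T (h : hom Z T) (g : hom Y Z) (f : hom X Y),
    comp h (comp g f) = comp (comp h g) f;
  comp_linl : forall X Y Z (f : hom X Y) a (g g' : hom Y Z),
    comp (a *: g + g') f = a *: comp g f + comp g' f;
  comp_linr : forall X Y Z (g : hom Y Z) a (f f' : hom X Y),
    comp g (a *: f + f') = a *: comp g f + comp g f'
}.
Arguments hom {k C} X Y : rename.
Arguments idm {k C} X : rename.
Arguments comp {k C X Y Z} g f : rename.
Notation "g \oc f" := (comp g f).

Section Morphisms.
Variables (k : fieldType) (C : kcat k).

Definition is_iso (X Y : C) (f : hom X Y) : Prop :=
  exists g : hom Y X, g \oc f = idm X /\ f \oc g = idm Y.

Definition isomorphic (X Y : C) : Prop := exists f : hom X Y, is_iso f.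

Definition mono (X Y : C) (f : hom X Y) : Prop :=
  forall T (u v : hom T X), f \oc u = f \oc v -> u = v.

Definition epi (X Y : C) (f : hom X Y) : Prop :=
  forall T (u v : hom Y T), u \oc f = v \oc f -> u = v.

(* Zero objects are the objects that are both initial and terminal; as hom
   spaces contain 0, uniqueness of morphisms is what is required. *)
Definition is_zero (Z : C) : Prop :=
  (forall Y (f : hom Z Y), f = 0) /\ (forall Y (f : hom Y Z), f = 0).

Definition is_dirsum n (S : 'I_n -> C) (X : C) : Prop :=
  exists (i : forall j, hom (S j) X) (p : forall j, hom X (S j)),
    [/\ forall j, p j \oc i j = idm (S j),
        forall j l, j != l -> p l \oc i j = 0
      & \sum_j i j \oc p j = idm X].

Definition is_biproduct (X Y Z : C) : Prop :=
  exists (i1 : hom X Z) (i2 : hom Y Z) (p1 : hom Z X) (p2 : hom Z Y),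
    [/\ p1 \oc i1 = idm X, p2 \oc i2 = idm Y, p1 \oc i2 = 0, p2 \oc i1 = 0
      & i1 \oc p1 + i2 \oc p2 = idm Z].

Definition is_kernel (X Y K : C) (f : hom X Y) (i : hom K X) : Prop :=
  f \oc i = 0 /\
  forall T (t : hom T X), f \oc t = 0 -> exists! s : hom T K, i \oc s = t.

Definition is_cokernel (X Y Q : C) (f : hom X Y) (q : hom Y Q) : Prop :=
  q \oc f = 0 /\
  forall T (t : hom Y T), t \oc f = 0 -> exists! s : hom Q T, s \oc q = t.

Record abelian : Prop := Abelian {
  ab_zero : exists Z : C, is_zero Z;
  ab_biproduct : forall X Y : C, exists Z, is_biproduct X Y Z;
  ab_kernel : forall (X Y : C) (f : hom X Y),
    exists K (i : hom K X), is_kernel f i;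
  ab_cokernel : forall (X Y : C) (f : hom X Y),
    exists Q (q : hom Y Q), is_cokernel f q;
  ab_mono : forall (X Y : C) (f : hom X Y), mono f ->
    exists Z (g : hom Y Z), is_kernel g f;
  ab_epi : forall (X Y : C) (f : hom X Y), epi f ->
    exists Z (g : hom Z X), is_cokernel g f
}.

(* [0 -> X -> Y -> Z -> 0] is exact *)
Definition short_exact (X Y Z : C) (i : hom X Y) (q : hom Y Z) : Prop :=
  is_kernel q i /\ is_cokernel i q.

Definition projective (P : C) : Prop :=
  forall (Y Z : C) (e : hom Y Z) (f : hom P Z), epi e ->
  exists g : hom P Y, e \oc g = f.

Definition simple (S : C) : Prop :=
  ~ is_zero S /\
  forall (T : C) (m : hom T S), mono m -> is_zero T \/ is_iso m.

Definition semisimple : Prop :=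
  forall X : C, exists n (S : 'I_n -> C),
    (forall i, simple (S i)) /\ is_dirsum S X.

Definition projective_cover (P X : C) : Prop :=
  projective P /\
  exists e : hom P X, epi e /\
    forall T (g : hom T P), epi (e \oc g) -> epi g.

(* [composition_series X s]: the list of the composition factors of some
   composition series of [X], from the top down, is [s]. *)
Inductive composition_series : C -> seq C -> Prop :=
| Comp_nil X : is_zero X -> composition_series X [::]
| Comp_cons X Y S s (i : hom Y X) (q : hom X S) :
    short_exact i q -> simple S -> composition_series Y s ->
    composition_series X (S :: s).

(* The multiplicity [X : L]. By Jordan-Hoelder it does not depend on the
   composition series; the default value 0 is returned only if [X] does not
   have finite length. *)
Definition multiplicity (X L : C) : nat :=
  xget 0%N [set m | exists2 s : seq C, composition_series X s &
                      count (fun S => `[< isomorphic S L >]) s = m].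

Definition simple_representatives n (L : 'I_n -> C) : Prop :=
  [/\ forall i, simple (L i),
      forall i j, isomorphic (L i) (L j) -> i = j
    & forall S : C, simple S -> exists i, isomorphic S (L i)].

End Morphisms.

Record kfunctor (k : fieldType) (C D : kcat k) := KFunctor {
  fob :> C -> D;
  fmap : forall X Y : C, hom X Y -> hom (fob X) (fob Y);
  fmap_lin : forall X Y a (f g : hom X Y),
    fmap (a *: f + g) = a *: fmap f + fmap g;
  fmap1 : forall X, fmap (idm X) = idm (fob X);
  fmapM : forall X Y Z (g : hom Y Z) (f : hom X Y),
    fmap (g \oc f) = fmap g \oc fmap f
}.
Arguments fmap {k C D} F {X Y} f : rename.

Section Functors.
Variable k : fieldType.

Program Definition idF (C : kcat k) : kfunctor C C :=
  @KFunctor k C C id (fun _ _ f => f) _ _ _.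
Solve All Obligations with by [].

Program Definition compF (C D E : kcat k) (G : kfunctor D E)
  (F : kfunctor C D) : kfunctor C E :=
  @KFunctor k C E (fun X => G (F X)) (fun _ _ f => fmap G (fmap F f)) _ _ _.
Next Obligation. by move=> *; rewrite /= !fmap_lin. Qed.
Next Obligation. by move=> *; rewrite /= !fmap1. Qed.
Next Obligation. by move=> *; rewrite /= !fmapM. Qed.

Definition naturally_isomorphic (C D : kcat k) (F G : kfunctor C D) : Prop :=
  exists eta : forall X : C, hom (F X) (G X),
    (forall (X Y : C) (f : hom X Y), eta Y \oc fmap F f = fmap G f \oc eta X)
    /\ forall X, is_iso (eta X).

Definition equivalence (C D : kcat k) (F : kfunctor C D) : Prop :=
  exists G : kfunctor D C,
    naturally_isomorphic (compF G F) (idF C) /\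
    naturally_isomorphic (compF F G) (idF D).

Definition exact_functor (C D : kcat k) (F : kfunctor C D) : Prop :=
  forall (X Y Z : C) (i : hom X Y) (q : hom Y Z),
    short_exact i q -> short_exact (fmap F i) (fmap F q).

Definition preserves_projectives (C D : kcat k) (F : kfunctor C D) : Prop :=
  forall P : C, projective P -> projective (F P).

End Functors.

Record fdmod (k : fieldType) (A : falgType k) := FDMod {
  fdmod_sort :> vectType k;
  act : A -> fdmod_sort -> fdmod_sort;
  act_linl : forall v c a b, act (c *: a + b) v = c *: act a v + act b v;
  act_linr : forall a c u v, act a (c *: u + v) = c *: act a u + act a v;
  act1 : forall v, act 1 v = v;
  actM : forall a b v, act (a * b) v = act a (act b v)
}.

Section Modules.
Variables (k : fieldType) (A : falgType k).

Definition equivariant (V W : fdmod A) : pred 'Hom(V, W) :=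
  fun f => `[< forall a v, f (act a v) = act a (f v) >].

Lemma equivariant_closed (V W : fdmod A) : submod_closed (@equivariant V W).
Proof.
split.
  apply/asboolP => a v; rewrite !lfunE /=; apply: (addrI (act a (0 : W))).
  by rewrite addr0 -{2}[act a 0]scale1r -act_linr scaler0 addr0.
move=> c f g /asboolP hf /asboolP hg; apply/asboolP => a v.
by rewrite !lfunE /= !lfunE /= hf hg act_linr.
Qed.

HB.instance Definition _ (V W : fdmod A) :=
  GRing.isSubmodClosed.Build k 'Hom(V, W) (@equivariant V W)
    (@equivariant_closed V W).

Record modhom (V W : fdmod A) := ModHom {
  modhom_val :> 'Hom(V, W);
  modhom_equivariant : equivariant modhom_val
}.

Section ModHom.
Variables V W : fdmod A.
HB.instance Definition _ := [isSub for @modhom_val V W].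
HB.instance Definition _ := [Choice of modhom V W by <:].
HB.instance Definition _ := [SubChoice_isSubLmodule of modhom V W by <:].
End ModHom.

Lemma modhom_id_subproof (V : fdmod A) : @equivariant V V \1%VF.
Proof. by apply/asboolP => a v; rewrite !lfunE. Qed.

Lemma modhom_comp_subproof (U V W : fdmod A) (g : modhom V W)
  (f : modhom U V) : equivariant (g \o f)%VF.
Proof.
apply/asboolP => a v; rewrite !lfunE /=.
have /asboolP -> := modhom_equivariant f.
by have /asboolP -> := modhom_equivariant g.
Qed.

Definition modhom_id (V : fdmod A) : modhom V V :=
  ModHom (modhom_id_subproof V).
Definition modhom_comp (U V W : fdmod A) (g : modhom V W) (f : modhom U V) :
  modhom U W := ModHom (modhom_comp_subproof g f).

Program Definition modcat : kcat k :=
  @KCat k (fdmod A) (fun V W => modhom V W) modhom_id modhom_comp _ _ _ _ _.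
Next Obligation. by move=> *; apply/val_inj; rewrite /= comp_lfun1l. Qed.
Next Obligation. by move=> *; apply/val_inj; rewrite /= comp_lfun1r. Qed.
Next Obligation. by move=> *; apply/val_inj; rewrite /= comp_lfunA. Qed.
Next Obligation.
by move=> *; apply/val_inj; rewrite /= comp_lfunDl comp_lfunZl.
Qed.
Next Obligation.
by move=> *; apply/val_inj; rewrite /= comp_lfunDr comp_lfunZr.
Qed.

End Modules.

(* The zero algebra is not a [falgType]: this only excludes the zero category. *)
Definition finite_category (k : fieldType) (C : kcat k) : Prop :=
  abelian C /\
  exists (A : falgType k) (F : kfunctor C (modcat A)), equivalence F.

Section QuotientModule.
Variables (k : fieldType) (V : lmodType k) (S : pred V).
Hypothesis S_closed : submod_closed S.
Local Open Scope quotient_scope.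

Definition submod_pred (_ : submod_closed S) : {pred V} := S.
Local Notation I := (submod_pred S_closed).
HB.instance Definition _ :=
  GRing.isSubmodClosed.Build k V I (GRing.submod_closed_semi S_closed).
HB.instance Definition _ :=
  GRing.isZmodClosed.Build V I (GRing.submod_closedB S_closed).

Let Q := @Quotient.quot V I.
Definition lmod_quot : Type := Q.
HB.instance Definition _ := Choice.copy lmod_quot (@Quotient.quot V I).
HB.instance Definition _ := GRing.Zmodule.copy lmod_quot (@Quotient.quot V I).

Definition lmod_proj (v : V) : lmod_quot := \pi_(@Quotient.quot V I) v.
Definition lmod_repr (x : lmod_quot) : V := repr (x : @Quotient.quot V I).

Lemma lmod_reprK x : lmod_proj (lmod_repr x) = x.
Proof. exact: (@reprK _ (@Quotient.quot V I)). Qed.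

Lemma lmod_projP u v : reflect (lmod_proj u = lmod_proj v) (u - v \in I).
Proof. by rewrite Quotient.idealrBE; exact: eqP. Qed.

Lemma lmod_repr_proj v : lmod_repr (lmod_proj v) - v \in I.
Proof. by apply/lmod_projP; rewrite lmod_reprK. Qed.

Lemma lmod_projD u v : lmod_proj (u + v) = lmod_proj u + lmod_proj v.
Proof. exact: (Quotient.pi_add I u v). Qed.

Definition lmod_quot_scale (a : k) (x : lmod_quot) : lmod_quot :=
  lmod_proj (a *: lmod_repr x).

Lemma lmod_projZ_subproof a v :
  lmod_quot_scale a (lmod_proj v) = lmod_proj (a *: v).
Proof.
by apply/lmod_projP; rewrite -scalerBr; apply/rpredZ/lmod_repr_proj.
Qed.

Lemma lmod_quot_scalerA a b x :
  lmod_quot_scale a (lmod_quot_scale b x) = lmod_quot_scale (a * b) x.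
Proof.
by rewrite -[x]lmod_reprK !lmod_projZ_subproof scalerA.
Qed.

Lemma lmod_quot_scale1r : left_id 1 lmod_quot_scale.
Proof. by move=> x; rewrite -[x]lmod_reprK lmod_projZ_subproof scale1r. Qed.

Lemma lmod_quot_scalerDr : right_distributive lmod_quot_scale +%R.
Proof.
move=> a x y; rewrite -[x]lmod_reprK -[y]lmod_reprK -lmod_projD.
by rewrite !lmod_projZ_subproof scalerDr lmod_projD.
Qed.

Lemma lmod_quot_scalerDl x :
  {morph lmod_quot_scale^~ x : a b / a + b}.
Proof.
move=> a b; rewrite -[x]lmod_reprK !lmod_projZ_subproof.
by rewrite scalerDl lmod_projD.
Qed.

HB.instance Definition _ := GRing.Zmodule_isLmodule.Build k lmod_quot
  lmod_quot_scalerA lmod_quot_scale1r lmod_quot_scalerDr lmod_quot_scalerDl.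

Lemma lmod_projZ a v : lmod_proj (a *: v) = a *: lmod_proj v.
Proof. by rewrite -lmod_projZ_subproof. Qed.

Lemma lmod_proj_lin a u v :
  lmod_proj (a *: u + v) = a *: lmod_proj u + lmod_proj v.
Proof. by rewrite lmod_projD lmod_projZ. Qed.

End QuotientModule.
Arguments lmod_proj {k V S} S_closed v.
Arguments lmod_repr {k V S S_closed} x.

Section ProjectiveMorphisms.
Variables (k : fieldType) (C : kcat k).

Definition factors_through_projective (X Y : C) (f : hom X Y) : Prop :=
  exists (P : C) (g : hom X P) (h : hom P Y), projective P /\ f = h \oc g.

Lemma comp0m (X Y Z : C) (f : hom X Y) : (0 : hom Y Z) \oc f = 0.
Proof.
apply: (addrI ((0 : hom Y Z) \oc f)).
by rewrite addr0 -{1}[_ \oc f]scale1r -comp_linl scaler0 addr0.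
Qed.

Lemma compm0 (X Y Z : C) (g : hom Y Z) : g \oc (0 : hom X Y) = 0.
Proof.
apply: (addrI (g \oc (0 : hom X Y))).
by rewrite addr0 -{1}[g \oc _]scale1r -comp_linr scaler0 addr0.
Qed.

Lemma compDl (X Y Z : C) (f : hom X Y) (g g' : hom Y Z) :
  (g + g') \oc f = g \oc f + g' \oc f.
Proof. by have := comp_linl f 1 g g'; rewrite !scale1r. Qed.

Lemma compDr (X Y Z : C) (g : hom Y Z) (f f' : hom X Y) :
  g \oc (f + f') = g \oc f + g \oc f'.
Proof. by have := comp_linr g 1 f f'; rewrite !scale1r. Qed.

Lemma compZl (X Y Z : C) (f : hom X Y) a (g : hom Y Z) :
  (a *: g) \oc f = a *: (g \oc f).
Proof. by have := comp_linl f a g 0; rewrite comp0m !addr0. Qed.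

Lemma compZr (X Y Z : C) (f : hom X Y) a (g : hom Y Z) :
  g \oc (a *: f) = a *: (g \oc f).
Proof. by have := comp_linr g a f 0; rewrite compm0 !addr0. Qed.

Lemma compBl (X Y Z : C) (f : hom X Y) (g g' : hom Y Z) :
  (g - g') \oc f = g \oc f - g' \oc f.
Proof. by rewrite compDl -scaleN1r compZl scaleN1r. Qed.

Lemma compBr (X Y Z : C) (g : hom Y Z) (f f' : hom X Y) :
  g \oc (f - f') = g \oc f - g \oc f'.
Proof. by rewrite compDr -scaleN1r compZr scaleN1r. Qed.

Lemma projective_biproduct (P Q Z : C) :
  is_biproduct P Q Z -> projective P -> projective Q -> projective Z.
Proof.
move=> [i1 [i2 [p1 [p2 [_ _ _ _ dec]]]]] prP prQ Y T e f epi_e.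
have [g1 e1] := prP _ _ e (f \oc i1) epi_e.
have [g2 e2] := prQ _ _ e (f \oc i2) epi_e.
exists (g1 \oc p1 + g2 \oc p2).
by rewrite compDr !compA e1 e2 -!compA -compDr dec compm1.
Qed.

Lemma factors_through_projectiveMl (X Y Z : C) (g : hom Y Z) (f : hom X Y) :
  factors_through_projective f -> factors_through_projective (g \oc f).
Proof.
by move=> [P [u [v [prP ->]]]]; exists P, u, (g \oc v); rewrite compA.
Qed.

Lemma factors_through_projectiveMr (X Y Z : C) (g : hom Y Z) (f : hom X Y) :
  factors_through_projective g -> factors_through_projective (g \oc f).
Proof.
by move=> [P [u [v [prP ->]]]]; exists P, (u \oc f), v; rewrite compA.
Qed.

Hypothesis abC : abelian C.

Definition projective_ideal (X Y : C) : pred (hom X Y) :=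
  fun f => `[< factors_through_projective f >].

Lemma projective_ideal_closed (X Y : C) :
  submod_closed (@projective_ideal X Y).
Proof.
split=> [|a f g].
  apply/asboolP; have [Z [Z0 Z1]] := ab_zero abC.
  exists Z, 0, 0; split; last by rewrite comp0m.
  by move=> U T e f _; exists 0; rewrite (Z0 _ f) compm0.
move=> /asboolP[P [u [v [prP ->]]]] /asboolP[Q [u' [v' [prQ ->]]]].
apply/asboolP; have [Z biZ] := ab_biproduct abC P Q.
have prZ := projective_biproduct biZ prP prQ.
have [i1 [i2 [p1 [p2 [h11 h22 h12 h21 _]]]]] := biZ.
exists Z, (a *: (i1 \oc u) + i2 \oc u'), (v \oc p1 + v' \oc p2); split=> //.
rewrite compDr compZr !compDl !compA.
rewrite -(compA v p1 i1) -(compA v p1 i2) -(compA v' p2 i1) -(compA v' p2 i2).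
by rewrite h11 h12 h21 h22 !compm1 !compm0 !comp0m addr0 add0r.
Qed.

End ProjectiveMorphisms.

Section Stable.
Variables (k : fieldType) (C : kcat k) (abC : abelian C).

Definition stable_hom (X Y : C) : lmodType k :=
  lmod_quot (projective_ideal_closed abC X Y).
Definition stable_class (X Y : C) (f : hom X Y) : stable_hom X Y :=
  lmod_proj (projective_ideal_closed abC X Y) f.
Definition stable_comp (X Y Z : C) (g : stable_hom Y Z) (f : stable_hom X Y) :
  stable_hom X Z := stable_class (lmod_repr g \oc lmod_repr f).

Lemma stable_classP (X Y : C) (f g : hom X Y) :
  stable_class f = stable_class g <-> factors_through_projective (f - g).
Proof.
split=> [/lmod_projP h|h]; first exact/asboolP.
by apply/lmod_projP/asboolP.
Qed.

Lemma stable_repr_class (X Y : C) (f : hom X Y) :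
  factors_through_projective (lmod_repr (stable_class f) - f).
Proof. by apply/stable_classP; rewrite /stable_class lmod_reprK. Qed.

Lemma stable_compE (X Y Z : C) (g : hom Y Z) (f : hom X Y) :
  stable_comp (stable_class g) (stable_class f) = stable_class (g \oc f).
Proof.
rewrite /stable_comp; set g' := lmod_repr _; set f' := lmod_repr _.
have Dg : factors_through_projective (g' - g).
  exact: stable_repr_class.
have Df : factors_through_projective (f' - f).
  exact: stable_repr_class.
transitivity (stable_class (g \oc f')); apply/stable_classP.
  by rewrite -compBl; apply: factors_through_projectiveMr.
by rewrite -compBr; apply: factors_through_projectiveMl.
Qed.

Lemma stable_class_surj (X Y : C) (u : stable_hom X Y) :
  exists f, u = stable_class f.
Proof. by exists (lmod_repr u); rewrite /stable_class lmod_reprK. Qed.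

Lemma stable_class_lin (X Y : C) a (f g : hom X Y) :
  stable_class (a *: f + g) = a *: stable_class f + stable_class g.
Proof. exact: lmod_proj_lin. Qed.

Program Definition stable : kcat k :=
  @KCat k C stable_hom (fun X => stable_class (idm X)) stable_comp _ _ _ _ _.
Next Obligation.
by move=> X Y u; have [f ->] := stable_class_surj u; rewrite stable_compE comp1m.
Qed.
Next Obligation.
by move=> X Y u; have [f ->] := stable_class_surj u; rewrite stable_compE compm1.
Qed.
Next Obligation.
move=> X Y Z T u v w; have [f ->] := stable_class_surj u.
have [g ->] := stable_class_surj v; have [h ->] := stable_class_surj w.
by rewrite !stable_compE compA.
Qed.
Next Obligation.
move=> X Y Z u a v w; have [f ->] := stable_class_surj u.
have [g ->] := stable_class_surj v; have [h ->] := stable_class_surj w.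
by rewrite -stable_class_lin !stable_compE comp_linl stable_class_lin.
Qed.
Next Obligation.
move=> X Y Z u a v w; have [f ->] := stable_class_surj u.
have [g ->] := stable_class_surj v; have [h ->] := stable_class_surj w.
by rewrite -stable_class_lin !stable_compE comp_linr stable_class_lin.
Qed.

End Stable.

Section StableFunctor.
Variables (k : fieldType) (C D : kcat k) (abC : abelian C) (abD : abelian D).
Variables (F : kfunctor C D) (projF : preserves_projectives F).

Definition stable_fmap (X Y : C) (u : stable_hom abC X Y) :
  stable_hom abD (F X) (F Y) := stable_class abD (fmap F (lmod_repr u)).

Lemma fmapB (X Y : C) (f g : hom X Y) : fmap F (f - g) = fmap F f - fmap F g.
Proof.
by rewrite addrC -scaleN1r fmap_lin scaleN1r addrC.
Qed.

Lemma stable_fmapE (X Y : C) (f : hom X Y) :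
  stable_fmap (stable_class abC f) = stable_class abD (fmap F f).
Proof.
apply/stable_classP; rewrite -fmapB; set g := _ - f.
have [P [u [v [prP ->]]]] : factors_through_projective g.
  exact: stable_repr_class.
by exists (F P), (fmap F u), (fmap F v); rewrite fmapM; split=> //; apply: projF.
Qed.

Program Definition stable_functor : kfunctor (stable abC) (stable abD) :=
  @KFunctor k (stable abC) (stable abD) (fob F) stable_fmap _ _ _.
Next Obligation.
move=> X Y a u v; have [f ->] := stable_class_surj u.
have [g ->] := stable_class_surj v.
by rewrite -stable_class_lin !stable_fmapE fmap_lin stable_class_lin.
Qed.
Next Obligation. by move=> X; rewrite /= stable_fmapE fmap1. Qed.
Next Obligation.
move=> X Y Z v u; have [f ->] := stable_class_surj u.
have [g ->] := stable_class_surj v.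
by rewrite /= stable_compE !stable_fmapE stable_compE fmapM.
Qed.

End StableFunctor.

Record moncat (k : fieldType) := MonCat {
  mon_cat :> kcat k;
  tens : mon_cat -> mon_cat -> mon_cat;
  tensm : forall X X' Y Y' : mon_cat,
    hom X X' -> hom Y Y' -> hom (tens X Y) (tens X' Y');
  tens1 : forall X Y, tensm (idm X) (idm Y) = idm (tens X Y);
  tensM : forall X X' X'' Y Y' Y'' (f' : hom X' X'') (f : hom X X')
    (g' : hom Y' Y'') (g : hom Y Y'),
    tensm (f' \oc f) (g' \oc g) = tensm f' g' \oc tensm f g;
  tens_linl : forall X X' Y Y' (g : hom Y Y') a (f f' : hom X X'),
    tensm (a *: f + f') g = a *: tensm f g + tensm f' g;
  tens_linr : forall X X' Y Y' (f : hom X X') a (g g' : hom Y Y'),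
    tensm f (a *: g + g') = a *: tensm f g + tensm f g';
  unitob : mon_cat;
  assoc : forall X Y Z, hom (tens (tens X Y) Z) (tens X (tens Y Z));
  associ : forall X Y Z, hom (tens X (tens Y Z)) (tens (tens X Y) Z);
  lunit : forall X, hom (tens unitob X) X;
  runit : forall X, hom (tens X unitob) X;
  assocK : forall X Y Z, associ X Y Z \oc assoc X Y Z = idm _;
  associK : forall X Y Z, assoc X Y Z \oc associ X Y Z = idm _;
  lunit_iso : forall X, is_iso (lunit X);
  runit_iso : forall X, is_iso (runit X);
  assoc_natural : forall X X' Y Y' Z Z'
    (f : hom X X') (g : hom Y Y') (h : hom Z Z'),
    assoc X' Y' Z' \oc tensm (tensm f g) h =
    tensm f (tensm g h) \oc assoc X Y Z;
  lunit_natural : forall X Y (f : hom X Y),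
    lunit Y \oc tensm (idm unitob) f = f \oc lunit X;
  runit_natural : forall X Y (f : hom X Y),
    runit Y \oc tensm f (idm unitob) = f \oc runit X;
  pentagon : forall X Y Z T,
    assoc X Y (tens Z T) \oc assoc (tens X Y) Z T =
    tensm (idm X) (assoc Y Z T) \oc assoc X (tens Y Z) T
      \oc tensm (assoc X Y Z) (idm T);
  triangle : forall X Y,
    tensm (idm X) (lunit Y) \oc assoc X unitob Y = tensm (runit X) (idm Y)
}.
Arguments tens {k C} X Y : rename.
Arguments tensm {k C X X' Y Y'} f g : rename.
Arguments unitob {k} C : rename.
Arguments assoc {k C} X Y Z : rename.
Arguments associ {k C} X Y Z : rename.
Arguments lunit {k C} X : rename.
Arguments runit {k C} X : rename.
Notation "X \ox Y" := (tens X Y).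
Notation "f \oxm g" := (tensm f g).

Record monfunctor (k : fieldType) (C D : moncat k) := MonFunctor {
  mon_functor :> kfunctor C D;
  mon_tens : forall X Y : C,
    hom (mon_functor X \ox mon_functor Y) (mon_functor (X \ox Y));
  mon_unit : hom (unitob D) (mon_functor (unitob C));
  mon_tens_iso : forall X Y, is_iso (mon_tens X Y);
  mon_unit_iso : is_iso mon_unit;
  mon_tens_natural : forall X X' Y Y' (f : hom X X') (g : hom Y Y'),
    mon_tens X' Y' \oc (fmap mon_functor f \oxm fmap mon_functor g) =
    fmap mon_functor (f \oxm g) \oc mon_tens X Y;
  mon_hexagon : forall X Y Z,
    fmap mon_functor (assoc X Y Z) \oc mon_tens (X \ox Y) Z
      \oc (mon_tens X Y \oxm idm (mon_functor Z)) =
    mon_tens X (Y \ox Z) \oc (idm (mon_functor X) \oxm mon_tens Y Z)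
      \oc assoc (mon_functor X) (mon_functor Y) (mon_functor Z);
  mon_lunit : forall X,
    fmap mon_functor (lunit X) \oc mon_tens (unitob C) X
      \oc (mon_unit \oxm idm (mon_functor X)) = lunit (mon_functor X);
  mon_runit : forall X,
    fmap mon_functor (runit X) \oc mon_tens X (unitob C)
      \oc (idm (mon_functor X) \oxm mon_unit) = runit (mon_functor X)
}.

Section Rigid.
Variables (k : fieldType) (C : moncat k).

(* [X'] is a left dual of [X]; equivalently [X] is a right dual of [X'].
   The two identities are the usual zig-zag identities, with the inverses of
   the unit constraints moved to the other side. *)
Definition left_dual (X' X : C) : Prop :=
  exists (ev : hom (X' \ox X) (unitob C)) (coev : hom (unitob C) (X \ox X')),
    runit X \oc (idm X \oxm ev) \oc assoc X X' X \oc (coev \oxm idm X)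
      = lunit X /\
    lunit X' \oc (ev \oxm idm X') \oc associ X' X X' \oc (idm X' \oxm coev)
      = runit X'.

Definition rigid : Prop :=
  forall X : C, (exists X', left_dual X' X) /\ (exists X', left_dual X X').

End Rigid.

Record ftcat (k : fieldType) := FTCat {
  ft_mon :> moncat k;
  ft_finite : finite_category ft_mon;
  ft_rigid : rigid ft_mon;
  ft_end_unit : bijective (fun a : k => a *: idm (unitob ft_mon))
}.

Definition ft_abelian (k : fieldType) (C : ftcat k) : abelian C :=
  proj1 (ft_finite C).

Definition induces_stable_equivalence (k : fieldType) (C D : ftcat k)
    (F : kfunctor C D) : Prop :=
  exists projF : preserves_projectives F,
    equivalence (stable_functor (ft_abelian C) (ft_abelian D) projF).

Definition tensor_equivalence (k : fieldType) (C D : ftcat k)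
    (F : monfunctor C D) : Prop := equivalence F.

Section FPdim.
Variables (R : realType) (k : fieldType) (C : moncat k).

(* Matrix of left multiplication by [X] on the Grothendieck ring, in the basis
   of the classes of the simple objects [L i]: row [i] lists the coefficients
   of [X] * [L i]. *)
Definition multiplication_matrix n (L : 'I_n -> C) (X : C) : 'M[R]_n :=
  \matrix_(i, j) (multiplicity (X \ox L i) (L j))%:R.

(* The largest positive eigenvalue; the default value 0 is the dimension of
   the zero object, whose matrix has no positive eigenvalue. *)
Definition FPdim_obj n (L : 'I_n -> C) (X : C) : R :=
  xget 0 [set d | [/\ 0 < d, eigenvalue (multiplication_matrix L X) d
                   & forall x, eigenvalue (multiplication_matrix L X) x ->
                               x <= d]].

(* The sum of FPdim(L_i) FPdim(P_i) does not depend on the representatives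
   [L i] nor on the projective covers [P i], which exist in every finite
   tensor category. *)
Definition FPdim : R :=
  xget 0 [set d | exists n (L P : 'I_n -> C),
    [/\ simple_representatives L,
        forall i, projective_cover (P i) (L i)
      & d = \sum_i FPdim_obj L (L i) * FPdim_obj L (P i)]].

End FPdim.
Arguments FPdim R {k} C.

(* Main.v *)
(* Let L_i, P_i be the simple objects of C and their projective covers, L'_j,
   P'_j those of C', and d, d' the Frobenius-Perron dimensions.  Restricting a
   positive eigenvector along F shows d' (F X) = d X.  Since F P_i is projective,
   it is a sum of copies of the P'_j with multiplicities
   a_ij = dim Hom (F P_i, L'_j), so
     FPdim C = sum_i d(L_i) d'(F P_i) = sum_j (sum_i a_ij d(L_i)) d'(P'_j).
   The stable equivalence yields a nonzero map F X -> L'_j, because L'_j is not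
   projective.  For X of minimal length this map embeds Hom (P_i, X) into
   Hom (F P_i, L'_j), hence
     sum_i a_ij d(L_i) >= d X = d' (F X) >= d'(L'_j).
   As FPdim C = FPdim C' = sum_j d'(L'_j) d'(P'_j), all these are equalities:
   F X is isomorphic to L'_j and every map F P_i -> F X comes from C.  Thus F is
   full on the P_i, first with simple and then with arbitrary targets, and every
   object of C' is a quotient of some F Q; presentations by such objects show that
   F is full and essentially surjective.  It is faithful because it is exact and
   monoidal. *)

From HB Require Import structures.
From mathcomp Require Import all_boot all_order all_algebra all_field.
From mathcomp Require Import zify lra.
From mathcomp Require Import boolp classical_sets functions reals.
From mathcomp Require Import topology normedtype derive.
Require Import Defs.

Set Implicit Arguments.
Unset Strict Implicit.
Unset Printing Implicit Defensive.

Import Order.TTheory GRing.Theory Num.Theory.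
Local Open Scope ring_scope.
Local Obligation Tactic := idtac.


(** * Finite-dimensional spaces *)

(** [FPdim_obj] is a largest eigenvalue, a form from which neither additivity nor multiplicativity
    can be read off. Both come from one additive function, positive on nonzero objects, that every
    left multiplication rescales: for a nonnegative matrix, an eigenvalue with a strictly positive
    eigenvector is automatically the largest. Such a function is a Perron vector of a strictly
    positive matrix, and the positivity comes from rigidity: the unit is simple, so coevaluation is
    a monomorphism and every object embeds into some [X \ox Z] as soon as [X] is nonzero. The same
    embedding of the unit explains why an exact monoidal functor is faithful. Multiplicities are
    handled as dimensions of [Hom (P i, -)]; here algebraic closedness enters, since it makes
    [Hom (P i, L i)] a line. No matching between the simple objects of the two categories is known
    beforehand, not even that their numbers agree; the weighted sums compare them without one, and
    the matching comes out of the equality case. *)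

Section FiniteDimension.
Variable k : fieldType.
Implicit Types V W U : lmodType k.

(** Hom spaces of a [kcat] are bare [lmodType]s, so finite dimension is a property, the existence of
    coordinates, and not a structure. *)
Definition has_dim V n :=
  exists f : {linear 'rV[k]_n -> V}, bijective f.

Definition linear_pack V W (g : V -> W) (gl : linear g) : {linear V -> W} :=
  HB.pack_for {linear V -> W} g (GRing.isLinear.Build k V W _ g gl).

Lemma inj_surj_bij (T S : Type) (g : T -> S) :
  injective g -> (forall y, exists x, g x = y) -> bijective g.
Proof.
move=> ginj gsurj; have [h hP] := choice gsurj.
by exists h => // x; apply: ginj.
Qed.

Lemma has_dim_coord V n : has_dim V n ->
  exists g : {linear V -> 'rV[k]_n}, bijective g.
Proof.
move=> [f [g fK gK]].
have glin : linear g.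
  by move=> a u v; rewrite -{1}[u]gK -{1}[v]gK -linearP fK.
by exists (linear_pack glin), f.
Qed.

Lemma inj_rV_leq n m (f : {linear 'rV[k]_n -> 'rV[k]_m}) : injective f ->
  (n <= m)%N /\ (n = m -> forall w, exists v, f v = w).
Proof.
move=> injf; have fr : row_free (lin1_mx f).
  apply: inj_row_free => v; rewrite mul_rV_lin1 => fv0.
  by apply: injf; rewrite fv0 linear0.
split; first by have := rank_leq_col (lin1_mx f); rewrite (eqP fr).
move=> nm w; subst m; exists (w *m invmx (lin1_mx f)).
by rewrite -mul_rV_lin1 mulmxKV // -row_free_unit.
Qed.

(** The equality clause matters most: at the end of the proof it turns an equality of dimensions
    into surjectivity on Hom spaces. *)
Lemma has_dim_inj V W n m (g : V -> W) : has_dim V n -> has_dim W m ->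
  linear g -> injective g ->
  (n <= m)%N /\ (n = m -> forall w, exists v, g v = w).
Proof.
move=> [f [f' fK f'K]] /has_dim_coord[h [h' hK h'K]] glin ginj.
pose G := linear_pack glin.
have ih : injective (h \o (G \o f)).
  by apply: inj_comp; [exact: can_inj hK | apply: inj_comp => //; exact: can_inj fK].
have [le surj] := inj_rV_leq ih; split=> // nm w.
have [v /= hv] := surj nm (h w); exists (f v).
exact: (can_inj hK).
Qed.

Lemma has_dim_uniq V n m : has_dim V n -> has_dim V m -> n = m.
Proof.
move=> hn hm; have lin : linear (@id V) by [].
apply/eqP; rewrite eqn_leq.
by rewrite (has_dim_inj hn hm lin _).1 // (has_dim_inj hm hn lin _).1.
Qed.

Lemma linear_fun0 V W (g : V -> W) : linear g -> g 0 = 0.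
Proof. by move=> gl; exact: (linear0 (linear_pack gl)). Qed.

Lemma linear_inj V W (g : V -> W) : linear g -> (forall v, g v = 0 -> v = 0) ->
  injective g.
Proof.
move=> gl g0 u v guv; apply/eqP; rewrite -subr_eq0; apply/eqP/g0.
by rewrite -[g _]/(linear_pack gl _) linearB /= guv subrr.
Qed.

(** Take the largest [n] such that ['rV[k]_n] embeds into [V]; a vector outside the image would
    extend the embedding by one coordinate. *)
Lemma has_dim_sub V m (g : V -> 'rV[k]_m) : linear g -> injective g ->
  exists n, has_dim V n.
Proof.
move=> glin ginj; pose G := linear_pack glin.
pose P n := `[< exists f : {linear 'rV[k]_n -> V}, injective f >].
have P0 : exists n, P n.
  exists 0%N; apply/asboolP.
  have zl : linear (fun _ : 'rV[k]_0 => 0 : V) by move=> a u v; rewrite scaler0 addr0.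
  by exists (linear_pack zl) => u v _; apply/rowP => -[].
have Pm n : P n -> (n <= m)%N.
  move=> /asboolP[f finj].
  by case: (@inj_rV_leq _ _ (G \o f)) => //; apply: inj_comp.
have [n /asboolP[f finj] maxn] := ex_maxnP P0 Pm.
exists n, f; apply: inj_surj_bij => // v; apply: contrapT => vf.
suff /maxn : P (n + 1)%N by rewrite addn1 ltnn.
pose h (c : 'rV[k]_(n + 1)) := f (lsubmx c) + rsubmx c 0 0 *: v.
have hl : linear h.
  move=> a c d; rewrite /h !linearP /= !mxE scalerDl scalerDr scalerA.
  by rewrite addrACA.
apply/asboolP; exists (linear_pack hl); apply: linear_inj => // c; rewrite /= /h.
have [r0|r0] := eqVneq (rsubmx c 0 0) 0.
  rewrite r0 scale0r addr0 => fc0; rewrite -[c]hsubmxK.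
  rewrite (_ : lsubmx c = 0); last by apply: finj; rewrite fc0 linear0.
  rewrite (_ : rsubmx c = 0) ?row_mx0 //.
  by apply/rowP => i; rewrite ord1 r0 mxE.
move=> /eqP; rewrite addr_eq0 => /eqP fc; case: vf.
exists (- (rsubmx c 0 0)^-1 *: lsubmx c).
by rewrite linearZ /= fc scaleNr scalerN opprK scalerA mulVf // scale1r.
Qed.

Lemma has_dim_exact U V W n m (i : U -> V) (p : V -> W) :
  linear i -> linear p -> injective i -> (forall w, exists v, p v = w) ->
  (forall u, p (i u) = 0) -> (forall v, p v = 0 -> exists u, i u = v) ->
  has_dim U n -> has_dim W m -> has_dim V (n + m).
Proof.
move=> il pl ii ps pi0 pk [f [f' fK f'K]] [g [g' gK g'K]].
pose I := linear_pack il; pose Q := linear_pack pl.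
have [s sP] := choice ps.
pose t (c : 'rV[k]_m) := \sum_j c 0 j *: s (g (delta_mx 0 j)).
have tP c : p (t c) = g c.
  rewrite -[p _]/(Q _) linear_sum [in RHS](row_sum_delta c) linear_sum.
  by apply: eq_bigr => j _; rewrite !linearZ /= sP.
have tl : linear t.
  move=> a c d; rewrite /t scaler_sumr -big_split /=; apply: eq_bigr => j _.
  by rewrite !mxE scalerDl scalerA.
pose h (c : 'rV[k]_(n + m)) := I (f (lsubmx c)) + t (rsubmx c).
have hl : linear h.
  by move=> a c d; rewrite /h !linearP tl scalerDr addrACA.
have Qh c : p (h c) = g (rsubmx c).
  by rewrite -[p _]/(Q _) linearD /= pi0 add0r tP.
exists (linear_pack hl); apply: inj_surj_bij => [|v].
  apply: linear_inj => // c /= hc0; have := Qh c; rewrite hc0 (linear_fun0 pl) => /esym gr.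
  have r0 : rsubmx c = 0 by apply: (can_inj gK); rewrite gr linear0.
  move: hc0; rewrite /h r0 (linear_fun0 tl) addr0 => if0.
  have l0 : lsubmx c = 0.
    by apply: (can_inj fK); apply: ii; rewrite /= in if0; rewrite if0 linear0 (linear_fun0 il).
  by rewrite -[c]hsubmxK r0 l0 row_mx0.
have [u uP] : exists u, i u = v - t (g' (p v)).
  by apply: pk; rewrite -[p _]/(Q _) linearB /= tP g'K subrr.
exists (row_mx (f' u) (g' (p v))).
by rewrite /= /h row_mxKl row_mxKr /= f'K uP subrK.
Qed.
End FiniteDimension.

(** * Abelian categories *)

Section Basics.
Variables (k : fieldType) (C : kcat k).
Implicit Types X Y Z T S : C.

Lemma mono0P X Y (f : hom X Y) :
  mono f <-> forall T (u : hom T X), f \oc u = 0 -> u = 0.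
Proof.
split=> [mf T u fu0|f0 T u v fuv]; first by apply: mf; rewrite fu0 compm0.
by apply/eqP; rewrite -subr_eq0; apply/eqP/f0; rewrite compBr fuv subrr.
Qed.

Lemma epi0P X Y (f : hom X Y) :
  epi f <-> forall T (u : hom Y T), u \oc f = 0 -> u = 0.
Proof.
split=> [mf T u fu0|f0 T u v fuv]; first by apply: mf; rewrite fu0 comp0m.
by apply/eqP; rewrite -subr_eq0; apply/eqP/f0; rewrite compBl fuv subrr.
Qed.

Lemma mono_comp X Y Z (g : hom Y Z) (f : hom X Y) :
  mono g -> mono f -> mono (g \oc f).
Proof. by move=> mg mf T u v; rewrite -!compA => /mg/mf. Qed.

Lemma epi_comp X Y Z (g : hom Y Z) (f : hom X Y) :
  epi g -> epi f -> epi (g \oc f).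
Proof. by move=> eg ef T u v; rewrite !compA => /ef/eg. Qed.

Lemma mono_compl X Y Z (g : hom Y Z) (f : hom X Y) : mono (g \oc f) -> mono f.
Proof. by move=> m T u v fuv; apply: m; rewrite -!compA fuv. Qed.

Lemma epi_compr X Y Z (g : hom Y Z) (f : hom X Y) : epi (g \oc f) -> epi g.
Proof. by move=> e T u v guv; apply: e; rewrite !compA guv. Qed.

Lemma iso_mono X Y (f : hom X Y) : is_iso f -> mono f.
Proof.
by move=> [g [gf _]]; apply: (@mono_compl _ _ _ g); rewrite gf => T u v; rewrite !comp1m.
Qed.

Lemma iso_epi X Y (f : hom X Y) : is_iso f -> epi f.
Proof.
by move=> [g [_ fg]]; apply: (@epi_compr _ _ _ _ g); rewrite fg => T u v; rewrite !compm1.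
Qed.

Lemma iso_id X : is_iso (idm X).
Proof. by exists (idm X); rewrite comp1m. Qed.

Lemma iso_comp X Y Z (g : hom Y Z) (f : hom X Y) :
  is_iso g -> is_iso f -> is_iso (g \oc f).
Proof.
move=> [g' [g'g gg']] [f' [f'f ff']]; exists (f' \oc g').
by rewrite -!compA (compA g') g'g comp1m f'f (compA f) ff' comp1m gg'.
Qed.

Lemma isomorphic_refl X : isomorphic X X.
Proof. by exists (idm X); exact: iso_id. Qed.

Lemma isomorphic_sym X Y : isomorphic X Y -> isomorphic Y X.
Proof. by move=> [f [g [gf fg]]]; exists g, f. Qed.

Lemma isomorphic_trans Y X Z : isomorphic X Y -> isomorphic Y Z -> isomorphic X Z.
Proof. by move=> [f fi] [g gi]; exists (g \oc f); exact: iso_comp. Qed.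

Lemma kernel_mono X Y K (f : hom X Y) (i : hom K X) : is_kernel f i -> mono i.
Proof.
move=> [fi0 ker] T u v iuv.
have fiu0 : f \oc (i \oc u) = 0 by rewrite compA fi0 comp0m.
have [w [_ uniq]] := ker _ _ fiu0.
by rewrite -(uniq u) // -(uniq v).
Qed.

Lemma cokernel_epi X Y Q (f : hom X Y) (q : hom Y Q) : is_cokernel f q -> epi q.
Proof.
move=> [qf0 cok] T u v uqv.
have uqf0 : (u \oc q) \oc f = 0 by rewrite -compA qf0 compm0.
have [w [_ uniq]] := cok _ _ uqf0.
by rewrite -(uniq u) // -(uniq v).
Qed.

Lemma kernel_lift X Y K (f : hom X Y) (i : hom K X) T (t : hom T X) :
  is_kernel f i -> f \oc t = 0 -> exists s, i \oc s = t.
Proof. by move=> [_ ker] /ker[s [sP _]]; exists s. Qed.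

Lemma cokernel_desc X Y Q (f : hom X Y) (q : hom Y Q) T (t : hom Y T) :
  is_cokernel f q -> t \oc f = 0 -> exists s, s \oc q = t.
Proof. by move=> [_ cok] /cok[s [sP _]]; exists s. Qed.

Lemma kernelI X Y K (f : hom X Y) (i : hom K X) : mono i -> f \oc i = 0 ->
  (forall T (t : hom T X), f \oc t = 0 -> exists s, i \oc s = t) ->
  is_kernel f i.
Proof.
move=> mi fi0 lift; split=> // T t /lift[s sP]; exists s; split=> // s' s'P.
by apply: mi; rewrite sP s'P.
Qed.

Lemma cokernelI X Y Q (f : hom X Y) (q : hom Y Q) : epi q -> q \oc f = 0 ->
  (forall T (t : hom Y T), t \oc f = 0 -> exists s, s \oc q = t) ->
  is_cokernel f q.
Proof.
move=> eq qf0 desc; split=> // T t /desc[s sP]; exists s; split=> // s' s'P.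
by apply: eq; rewrite sP s'P.
Qed.

Lemma zeroP X : is_zero X <-> idm X = 0.
Proof.
split=> [[h _]|id0]; first exact: h.
by split=> Y f; [rewrite -[f]compm1 id0 compm0 | rewrite -[f]comp1m id0 comp0m].
Qed.

Lemma mono_zero X Y (f : hom X Y) : mono f -> f = 0 -> is_zero X.
Proof.
by move=> mf f0; apply/zeroP; move/mono0P: mf; apply; rewrite f0 comp0m.
Qed.

Lemma epi_zero X Y (f : hom X Y) : epi f -> f = 0 -> is_zero Y.
Proof.
by move=> ef f0; apply/zeroP; move/epi0P: ef; apply; rewrite f0 compm0.
Qed.

Lemma zero_sub X Y (f : hom X Y) : mono f -> is_zero Y -> is_zero X.
Proof. by move=> mf [_ zY]; apply: mono_zero mf (zY _ _). Qed.

Lemma zero_quotient X Y (f : hom X Y) : epi f -> is_zero X -> is_zero Y.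
Proof. by move=> ef [zX _]; apply: epi_zero ef (zX _ _). Qed.

Lemma isomorphic_zero X Y : isomorphic X Y -> is_zero X -> is_zero Y.
Proof. by move=> [f /iso_epi fe]; exact: (zero_quotient fe). Qed.

Lemma simple_iso X Y : isomorphic X Y -> simple X -> simple Y.
Proof.
move=> isoXY [nzX sX]; split=> [zY|T m mm].
  by apply: nzX; apply: isomorphic_zero zY; exact: isomorphic_sym.
have [f [g [gf fg]]] := isoXY.
have [|zT|[h [hgm gmh]]] := sX T (g \oc m); last 2 first.
- by left.
- right; exists (h \oc g); rewrite -compA hgm; split=> //.
  have := congr1 (fun u : hom X X => f \oc u \oc g) gmh.
  by rewrite compm1 fg !compA fg comp1m.
by apply: mono_comp mm; apply: iso_mono; exists f.
Qed.

Lemma projective_retract (P Q : C) (i : hom Q P) (p : hom P Q) :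
  p \oc i = idm Q -> projective P -> projective Q.
Proof.
move=> pi prP Y Z e f epi_e; have [g gP] := prP _ _ e (f \oc p) epi_e.
by exists (g \oc i); rewrite compA gP -compA pi compm1.
Qed.

End Basics.

Section Abelian.
Variables (k : fieldType) (C : kcat k) (abC : abelian C).
Implicit Types X Y Z T S : C.

Lemma mono_kernel X Y Q (i : hom X Y) (q : hom Y Q) :
  mono i -> is_cokernel i q -> short_exact i q.
Proof.
move=> mi ciq; split=> //; have [qi0 _] := ciq.
have [Z [g kg]] := ab_mono abC mi; apply: kernelI => // T t qt0.
have [gi0 _] := kg; have [s sq] := cokernel_desc ciq gi0.
by apply: (kernel_lift kg); rewrite -sq -compA qt0 compm0.
Qed.

Lemma epi_cokernel X Y K (i : hom K X) (q : hom X Y) :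
  epi q -> is_kernel q i -> short_exact i q.
Proof.
move=> eq kiq; split=> //; have [qi0 _] := kiq.
have [Z [g cg]] := ab_epi abC eq; apply: cokernelI => // T t ti0.
have [qg0 _] := cg; have [s is_] := kernel_lift kiq qg0.
by apply: (cokernel_desc cg); rewrite -is_ compA ti0 comp0m.
Qed.

Lemma mono_ses X Y (i : hom X Y) : mono i ->
  exists Q (q : hom Y Q), short_exact i q.
Proof.
move=> mi; have [Q [q cq]] := ab_cokernel abC i.
by exists Q, q; exact: mono_kernel.
Qed.

Lemma epi_ses X Y (q : hom X Y) : epi q ->
  exists K (i : hom K X), short_exact i q.
Proof.
move=> mi; have [Q [i cq]] := ab_kernel abC q.
by exists Q, i; exact: epi_cokernel.
Qed.

Lemma mono_epi_iso X Y (f : hom X Y) : mono f -> epi f -> is_iso f.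
Proof.
move=> mf ef; have [Z [g kg]] := ab_mono abC mf.
have g0 : g = 0 by have [gf0 _] := kg; move/epi0P: ef; apply.
have [s fs] := kernel_lift (t := idm Y) kg (etrans (compm1 _) g0).
by exists s; split=> //; apply: mf; rewrite compA fs comp1m compm1.
Qed.

(** The image is the kernel [m] of the cokernel [q] of [f]. If [u] kills [p], then [f] factors
    through the subobject [K = ker u] of [I]; the cokernel [c] of [K] in [Y] then factors through
    [q] and kills [m], so [K] is all of [I] and [u = 0]. *)
Lemma image X Y (f : hom X Y) :
  exists I (p : hom X I) (m : hom I Y), [/\ epi p, mono m & f = m \oc p].
Proof.
have [Q [q cq]] := ab_cokernel abC f; have [qf0 _] := cq.
have [I [m km]] := ab_kernel abC q; have mm := kernel_mono km.
have [p mp] := kernel_lift km qf0; exists I, p, m; split=> //.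
apply/epi0P => T u up0; have [K [i ki]] := ab_kernel abC u.
have mi := kernel_mono ki; have [p' ip] := kernel_lift ki up0.
have [Q' [c [kc cc]]] := mono_ses (mono_comp mm mi).
have [s sq] : exists s, s \oc q = c.
  apply: (cokernel_desc cq); have [cm0 _] := cc.
  by rewrite -mp -ip !compA -(compA c) cm0 comp0m.
have [t mt] : exists t, (m \oc i) \oc t = m.
  by apply: (kernel_lift kc); have [qm0 _] := km; rewrite -sq -compA qm0 compm0.
have it : i \oc t = idm I by apply: mm; rewrite compA mt compm1.
by have [ui0 _] := ki; rewrite -[u]compm1 -it compA ui0 comp0m.
Qed.

Lemma not_mono_kernel X Y (f : hom X Y) : ~ mono f ->
  exists K (i : hom K X), [/\ mono i, ~ is_zero K & f \oc i = 0].
Proof.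
move=> nm; have [K [i ki]] := ab_kernel abC f; have [fi0 _] := ki.
exists K, i; split=> //; first exact: kernel_mono ki.
move=> [_ zK]; apply: nm; apply/mono0P => T u fu0.
by have [s <-] := kernel_lift ki fu0; rewrite (zK _ s) compm0.
Qed.

Lemma iso_ses X Y Z (f : hom X Y) : is_zero Z -> is_iso f ->
  short_exact (0 : hom Z X) f.
Proof.
move=> zZ fi; have fm := iso_mono fi.
apply: epi_cokernel; first exact: iso_epi.
apply: kernelI; rewrite ?compm0 //; first by move=> T u v _; rewrite (zZ.2 _ u) (zZ.2 _ v).
by move=> T t; move/mono0P: fm => h /h ->; exists 0; rewrite comp0m.
Qed.

Lemma to_simple_epi X S (f : hom X S) : simple S -> f <> 0 -> epi f.
Proof.
move=> [_ sS] f0; have [I [p [m [ep mm fE]]]] := image f.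
have [[zI _]|im] := sS _ _ mm.
  by case: f0; rewrite fE (zI _ m) comp0m.
by rewrite fE; apply: epi_comp => //; exact: iso_epi.
Qed.

Lemma from_simple_mono X S (f : hom S X) : simple S -> f <> 0 -> mono f.
Proof.
move=> [_ sS] f0; apply: contrapT => /not_mono_kernel[K [i [mi nzK fi0]]].
have [//|/iso_epi ei] := sS _ _ mi.
by apply: f0; move/epi0P: ei; apply.
Qed.

Lemma schur S T (f : hom S T) : simple S -> simple T -> f <> 0 -> is_iso f.
Proof.
move=> sS sT f0; apply: mono_epi_iso; first exact: from_simple_mono.
exact: to_simple_epi.
Qed.

End Abelian.

(** * Exact, faithful and full functors; equivalences *)

Section Functors.
Variables (k : fieldType).

Lemma fmap0 (C D : kcat k) (F : kfunctor C D) (X Y : C) :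
  fmap F (0 : hom X Y) = 0.
Proof. by rewrite -(subrr (0 : hom X Y)) fmapB subrr. Qed.

Lemma fob_zero (C D : kcat k) (F : kfunctor C D) (X : C) :
  is_zero X -> is_zero (F X).
Proof. by move=> /zeroP X0; apply/zeroP; rewrite -fmap1 X0 fmap0. Qed.

Lemma fmap_mono (C D : kcat k) (F : kfunctor C D) (X Y : C) (f : hom X Y) :
  abelian C -> exact_functor F -> mono f -> mono (fmap F f).
Proof.
by move=> abC exF /(mono_ses abC)[Q [q /exF[/kernel_mono]]].
Qed.

Lemma fmap_epi (C D : kcat k) (F : kfunctor C D) (X Y : C) (f : hom X Y) :
  abelian C -> exact_functor F -> epi f -> epi (fmap F f).
Proof.
by move=> abC exF /(epi_ses abC)[Q [q /exF[_ /cokernel_epi]]].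
Qed.

Definition faithful (C D : kcat k) (F : kfunctor C D) :=
  forall (X Y : C) (f : hom X Y), fmap F f = 0 -> f = 0.
Definition full (C D : kcat k) (F : kfunctor C D) :=
  forall (X Y : C) (g : hom (F X) (F Y)), exists f, fmap F f = g.
Definition ess_surj (C D : kcat k) (F : kfunctor C D) :=
  forall Y : D, exists X : C, isomorphic (F X) Y.

Lemma faithful_inj (C D : kcat k) (F : kfunctor C D) (X Y : C) (f g : hom X Y) :
  faithful F -> fmap F f = fmap F g -> f = g.
Proof.
move=> faiF fg; apply/eqP; rewrite -subr_eq0; apply/eqP/faiF.
by rewrite fmapB fg subrr.
Qed.

(** An exact functor preserves the epi-mono factorization, so [fmap F f = 0] forces [F] to kill the
    image of [f]. *)
Lemma exact_faithful (C D : kcat k) (F : kfunctor C D) :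
  abelian C -> exact_functor F ->
  (forall X, is_zero (F X) -> is_zero X) -> faithful F.
Proof.
move=> abC exF zF X Y f; have [I [p [m [ep mm ->]]]] := image abC f.
rewrite fmapM => Ff0.
have Fp := fmap_epi abC exF ep; have Fm := fmap_mono abC exF mm.
have Fp0 : fmap F p = 0 by move/mono0P: Fm; apply.
have [_ zI] := zF _ (epi_zero Fp Fp0).
by rewrite (zI _ p) compm0.
Qed.

Lemma faithful_reflects_epi (C D : kcat k) (F : kfunctor C D) (X Y : C)
  (f : hom X Y) : faithful F -> epi (fmap F f) -> epi f.
Proof.
move=> faiF /epi0P ef; apply/epi0P => T u uf0.
by apply: faiF; apply: ef; rewrite -fmapM uf0 fmap0.
Qed.

Lemma equivalenceI (C D : kcat k) (F : kfunctor C D) :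
  faithful F -> full F -> ess_surj F -> equivalence F.
Proof.
move=> faiF fulF esF.
have [o oP] := choice esF.
pose e Y := projT1 (cid (oP Y)).
have ei Y : is_iso (e Y) by exact: projT2 (cid (oP Y)).
pose e' Y := projT1 (cid (ei Y)).
have e'e Y : e' Y \oc e Y = idm _ by have [] := projT2 (cid (ei Y)).
have ee' Y : e Y \oc e' Y = idm _ by have [] := projT2 (cid (ei Y)).
pose pre X Y g := projT1 (cid (@fulF X Y g)).
have preK X Y (g : hom (F X) (F Y)) : fmap F (pre X Y g) = g.
  exact: projT2 (cid (@fulF X Y g)).
pose gmap Y Z (g : hom Y Z) : hom (o Y) (o Z) := pre _ _ (e' Z \oc g \oc e Y).
have glin X Y a (f g : hom X Y) : gmap X Y (a *: f + g) = a *: gmap X Y f + gmap X Y g.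
  apply: (faithful_inj faiF).
  by rewrite fmap_lin !preK comp_linr comp_linl.
have g1 X : gmap X X (idm X) = idm (o X).
  by apply: (faithful_inj faiF); rewrite preK fmap1 compm1.
have gM X Y Z (g : hom Y Z) (f : hom X Y) :
  gmap X Z (g \oc f) = gmap Y Z g \oc gmap X Y f.
  apply: (faithful_inj faiF).
  by rewrite fmapM !preK -!compA (compA (e Y)) ee' comp1m.
exists (@KFunctor k D C o gmap glin g1 gM); split.
  exists (fun X => pre _ _ (e (F X))); split=> [X Y f|X] /=.
    apply: (faithful_inj faiF).
    by rewrite !fmapM !preK !compA ee' comp1m.
  exists (pre _ _ (e' (F X))).
  by split; apply: (faithful_inj faiF); rewrite fmapM !preK fmap1.
exists e; split=> // X Y f /=.
by rewrite preK !compA ee' comp1m.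
Qed.

Section Equivalence.
Variables (C D : kcat k) (F : kfunctor C D).
Hypothesis eqF : equivalence F.

Lemma equivalence_faithful : faithful F.
Proof.
have [G [[eta [nat iso]] _]] := eqF; move=> X Y f Ff0.
have := nat _ _ f; rewrite /= Ff0 fmap0 compm0 => /esym fe0.
by move/epi0P: (iso_epi (iso X)); apply.
Qed.

Lemma equivalence_ess_surj : ess_surj F.
Proof.
have [G [_ [eta [nat iso]]]] := eqF; move=> Y; exists (G Y); exists (eta Y).
exact: iso.
Qed.

Lemma equivalence_inverse_faithful (G : kfunctor D C) :
  naturally_isomorphic (compF F G) (idF D) -> faithful G.
Proof.
move=> [eta [nat iso]] X Y f Gf0.
have := nat _ _ f; rewrite /= Gf0 fmap0 compm0 => /esym fe0.
by move/epi0P: (iso_epi (iso X)); apply.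
Qed.

Lemma equivalence_full : full F.
Proof.
have [G [[eta [nat iso]] niFG]] := eqF; move=> X Y g.
have [e' [e'e _]] := iso X; have Gfai := equivalence_inverse_faithful niFG.
exists (eta Y \oc fmap G g \oc e'); apply: (faithful_inj Gfai).
have := nat _ _ (eta Y \oc fmap G g \oc e').
rewrite /= -(compA _ e') e'e.
by rewrite compm1; apply: (iso_mono (iso Y)).
Qed.

End Equivalence.

End Functors.

(** * A projective generator *)

(** What is retained of the equivalence with a module category. All finiteness arguments below run
    on the dimension of [Hom (G, -)]. *)
Record fincat (k : fieldType) (C : kcat k) (G : C) : Prop := FinCat {
  fc_abelian :> abelian C;
  fc_hom : forall X Y : C, exists n, has_dim (hom X Y) n;
  fc_proj : projective G;
  fc_gen : forall X : C, ~ is_zero X -> exists f : hom G X, f <> 0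
}.

(** * Modules over a finite-dimensional algebra: orbits, submodules, images *)

Section Modules.
Variables (k : fieldType) (A : falgType k).

Program Definition regular_module : fdmod A :=
  @FDMod k A A (fun a b => a * b) _ _ _ _.
Next Obligation. by move=> v c a b /=; rewrite mulrDl scalerAl. Qed.
Next Obligation. by move=> a c u v /=; rewrite mulrDr scalerAr. Qed.
Next Obligation. by move=> v /=; rewrite mul1r. Qed.
Next Obligation. by move=> a b v /=; rewrite mulrA. Qed.

Lemma act_linear (V : fdmod A) v : linear (fun a => @act k A V a v).
Proof. by move=> c a b; rewrite act_linl. Qed.

Lemma orbit_equivariant (V : fdmod A) (v : V) :
  @equivariant k A regular_module V (linfun (linear_pack (act_linear v))).
Proof. by apply/asboolP => a b; rewrite !lfunE /= actM. Qed.

Definition orbit (V : fdmod A) (v : V) : modhom regular_module V :=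
  ModHom (orbit_equivariant v).

Lemma orbitE (V : fdmod A) (v : V) a : orbit v a = act a v.
Proof. by rewrite /orbit lfunE. Qed.

Lemma modhom_act (V W : fdmod A) (f : modhom V W) a v :
  f (act a v) = act a (f v).
Proof. by have /asboolP := modhom_equivariant f. Qed.

Section Submodule.
Variables (V : fdmod A) (U : {vspace V}).
Hypothesis stU : forall a v, v \in U -> @act k A V a v \in U.

Program Definition submodule : fdmod A :=
  @FDMod k A (subvs_of U) (fun a u => vsproj U (act a (vsval u))) _ _ _ _.
Next Obligation.
move=> v c a b /=; apply: val_inj => /=; rewrite act_linl.
by rewrite !vsprojK ?memvD ?memvZ ?stU ?subvsP.
Qed.
Next Obligation.
move=> a c u v /=; apply: val_inj => /=; rewrite act_linr.
by rewrite !vsprojK ?memvD ?memvZ ?stU ?subvsP.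
Qed.
Next Obligation. by move=> v /=; rewrite act1 vsvalK. Qed.
Next Obligation.
move=> a b v /=; apply: val_inj => /=.
by rewrite actM !vsprojK ?stU ?subvsP.
Qed.

Lemma sub_incl_equivariant : @equivariant k A submodule V (linfun vsval).
Proof. by apply/asboolP => a v; rewrite !lfunE /= vsprojK ?stU ?subvsP. Qed.
Definition sub_incl : modhom submodule V := ModHom sub_incl_equivariant.

Lemma corestr_equivariant (T : fdmod A) (f : modhom T V) :
  (limg f <= U)%VS -> @equivariant k A T submodule (linfun (vsproj U) \o f)%VF.
Proof.
move=> fU; apply/asboolP => a v; have fv w : f w \in U.
  by apply: (subvP fU); apply: memv_img; exact: memvf.
rewrite !lfunE /= !lfunE /=; apply: val_inj => /=.
by rewrite modhom_act !vsprojK ?stU.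
Qed.
End Submodule.

Lemma limg_stable (T V : fdmod A) (f : modhom T V) a v :
  v \in limg f -> @act k A V a v \in limg f.
Proof.
by move=> /memv_imgP[u _ ->]; rewrite -modhom_act memv_img ?memvf.
Qed.

Definition img_module (T V : fdmod A) (f : modhom T V) : fdmod A :=
  submodule (@limg_stable _ _ f).
Definition img_incl (T V : fdmod A) (f : modhom T V) : modhom (img_module f) V :=
  sub_incl (@limg_stable _ _ f).
Definition img_proj (T V : fdmod A) (f : modhom T V) : modhom T (img_module f) :=
  ModHom (corestr_equivariant (@limg_stable _ _ f) (subvv _)).

Lemma img_fact (T V : fdmod A) (f : modhom T V) v : vsval (img_proj f v) = f v.
Proof.
by rewrite /= !lfunE /= lfunE /= vsprojK // memv_img ?memvf.
Qed.

End Modules.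

Section FiniteCategory.
Import VectorInternalTheory.
Variables (k : fieldType) (C : kcat k).

Lemma modcat_comp (A : falgType k) (U V W : modcat A) (g : hom V W)
  (f : hom U V) (u : U : fdmod A) :
  (g \oc f : modhom U W) u = (g : modhom V W) ((f : modhom U V) u).
Proof. by rewrite /= lfunE. Qed.

Lemma modcat_id (A : falgType k) (U : modcat A) (u : U : fdmod A) :
  (idm U : modhom U U) u = u.
Proof. by rewrite /= lfunE. Qed.

Lemma modhomP (A : falgType k) (U V : fdmod A) (f g : modhom U V) :
  (forall u, f u = g u) -> f = g.
Proof. by move=> fg; apply/val_inj/lfunP. Qed.

Lemma regular_hom (A : falgType k) (V : fdmod A) (f g : modhom (regular_module A) V) :
  f 1 = g 1 -> f = g.
Proof.
move=> fg; apply: modhomP => a.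
have {1 2}-> : a = @act k A (regular_module A) a 1 by rewrite /= mulr1.
by rewrite !modhom_act fg.
Qed.

Variables (A : falgType k) (E : kfunctor C (modcat A)).
Hypotheses (abC : abelian C) (eqE : equivalence E).

(* [e] is the cokernel of some [g0] in [C], and the corestriction of [E e] to its
   image kills [E g0], so the inclusion of the image has a section. *)
Lemma fmap_surj (Y Z : C) (e : hom Y Z) (w : E Z : fdmod A) : epi e ->
  exists v, (fmap E e : modhom (E Y) (E Z)) v = w.
Proof.
move=> epi_e; have [T0 [g0 cg0]] := ab_epi abC epi_e; have [eg0 _] := cg0.
pose I : modcat A := img_module (fmap E e : modhom (E Y) (E Z)).
pose q : hom (E Y) I := img_proj (fmap E e : modhom (E Y) (E Z)).
pose i : hom I (E Z) := img_incl (fmap E e : modhom (E Y) (E Z)).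
have iq : i \oc q = fmap E e.
  apply: modhomP => v; rewrite modcat_comp.
  by rewrite -[RHS]img_fact /= lfunE.
have i_mono T (u u' : hom T I) : i \oc u = i \oc u' -> u = u'.
  move=> iu; apply: modhomP => x; apply: val_inj.
  have : (i \oc u : modhom T (E Z)) x = (i \oc u' : modhom T (E Z)) x by rewrite iu.
  by rewrite !modcat_comp /= !lfunE.
have [T [tau [tau' [t't tt']]]] := equivalence_ess_surj eqE I.
have [r rP] := equivalence_full eqE (tau' \oc q).
have [m mP] := equivalence_full eqE (i \oc tau).
have rg0 : r \oc g0 = 0.
  apply: (equivalence_faithful eqE); rewrite fmapM rP -compA.
  suff -> : q \oc fmap E g0 = 0 by rewrite compm0.
  by apply: i_mono; rewrite compA iq -fmapM eg0 fmap0 compm0.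
have [s sP] := cokernel_desc cg0 rg0.
have ms : m \oc s = idm Z.
  apply: epi_e; rewrite -compA sP; apply: (faithful_inj (equivalence_faithful eqE)).
  by rewrite comp1m fmapM mP rP -compA (compA tau) tt' comp1m.
have : (fmap E (m \oc s) : modhom (E Z) (E Z)) w = w.
  by rewrite ms fmap1 modcat_id.
rewrite fmapM mP -compA modcat_comp => <-.
set u := (_ w); have /memv_imgP[v _ vP] : vsval u \in limg (fmap E e : modhom (E Y) (E Z)).
  exact: subvsP.
by exists v; rewrite /= lfunE.
Qed.

(** [G] corresponds to the regular module. A map out of it is the choice of a vector, so
    surjectivity of epimorphisms makes it projective, and a nonzero vector gives a nonzero map. *)
Lemma modcat_fincat : exists G : C, fincat G.
Proof.
have [G [phi [psi [psiphi phipsi]]]] := equivalence_ess_surj eqE (regular_module A).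
exists G; split=> //.
- move=> X Y.
  pose h (f : hom X Y) := v2r (modhom_val (fmap E f : modhom (E X) (E Y))).
  apply: (@has_dim_sub _ _ _ h) => [a u v|].
    by rewrite /h fmap_lin -linearP.
  by move=> u v /v2r_inj/val_inj/(faithful_inj (equivalence_faithful eqE)).
- move=> Y Z e f epi_e.
  have [v vP] := fmap_surj ((fmap E f \oc psi : modhom _ _) 1) epi_e.
  have [g gP] := equivalence_full eqE ((orbit v : hom (regular_module A : modcat A) _) \oc phi).
  exists g; apply: (faithful_inj (equivalence_faithful eqE)); rewrite fmapM gP compA.
  rewrite -[RHS]compm1 -psiphi compA; congr (_ \oc _).
  by apply: regular_hom; rewrite modcat_comp orbitE act1 vP.
- move=> X nzX.
  have [v v0] : exists v : (E X : fdmod A), v <> 0.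
    apply: contrapT => nv; apply: nzX; apply/zeroP.
    apply: (equivalence_faithful eqE); rewrite fmap1; apply: modhomP => v.
    rewrite modcat_id [RHS]lfunE.
    by apply: contrapT => v0; apply: nv; exists v.
  have [g gP] := equivalence_full eqE ((orbit v : hom (regular_module A : modcat A) _) \oc phi).
  exists g => g0; apply: v0.
  have o0 : (orbit v : hom (regular_module A : modcat A) _) = 0.
    have <- : fmap E g \oc psi = (orbit v : hom (regular_module A : modcat A) _).
      by rewrite gP -compA phipsi; apply: compm1.
    by rewrite g0 fmap0 comp0m.
  by rewrite -[v]act1 -orbitE o0 lfunE.
Qed.

End FiniteCategory.

Lemma finite_fincat (k : fieldType) (C : kcat k) :
  finite_category C -> exists G : C, fincat G.
Proof. by move=> [abC [A [E eqE]]]; exact: modcat_fincat abC eqE. Qed.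

(** * Length and projective covers *)

(** The value is unique by [has_dim_uniq]; in a [fincat] the default 0 is never taken, by
    [hdimP]. *)
Definition hdim (k : fieldType) (C : kcat k) (X Y : C) : nat :=
  xget 0%N [set n | has_dim (hom X Y) n].

Section FiniteLength.
Variables (k : fieldType) (C : kcat k) (G : C) (fcC : fincat G).
Implicit Types X Y Z T S P : C.
Let abC : abelian C := fcC.

Lemma hdimP X Y : has_dim (hom X Y) (hdim X Y).
Proof.
rewrite /hdim; case: xgetP => // none.
by have [n hn] := fc_hom fcC X Y; case: (none n).
Qed.

Lemma hdim_ses P X Y Z (i : hom X Y) (q : hom Y Z) :
  projective P -> short_exact i q -> hdim P Y = (hdim P X + hdim P Z)%N.
Proof.
move=> prP [ki cq]; apply: has_dim_uniq (hdimP P Y) _.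
apply: (has_dim_exact (i := fun u : hom P X => i \oc u) (p := fun v : hom P Y => q \oc v));
  try exact: hdimP.
- by move=> a u v; rewrite comp_linr.
- by move=> a u v; rewrite comp_linr.
- by move=> u v; exact: (kernel_mono ki).
- by move=> w; exact: (prP _ _ q w (cokernel_epi cq)).
- by move=> u; rewrite compA ki.1 comp0m.
- by move=> v; exact: kernel_lift.
Qed.

Lemma hdim_mono P X Y (i : hom X Y) : mono i -> (hdim P X <= hdim P Y)%N /\
  (hdim P X = hdim P Y -> forall v : hom P Y, exists u, i \oc u = v).
Proof.
move=> mi; apply: (has_dim_inj (g := fun u => i \oc u) (hdimP P X) (hdimP P Y)).
  by move=> a u v; rewrite comp_linr.
by move=> u v; exact: mi.
Qed.

Lemma hdim_gt0 X Y (f : hom X Y) : f <> 0 -> (0 < hdim X Y)%N.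
Proof.
move=> f0; have [g [g' gK g'K]] := hdimP X Y; case: (hdim X Y) g g' gK g'K => // g g' _ g'K.
by case: f0; rewrite -[f]g'K (_ : g' f = 0) ?linear0 //; apply/rowP => -[].
Qed.

Lemma hdim0 X Y : (forall f : hom X Y, f = 0) -> hdim X Y = 0%N.
Proof.
move=> h0; apply: has_dim_uniq (hdimP X Y) _.
have zl : linear (fun _ : 'rV[k]_0 => 0 : hom X Y).
  by move=> a u v; rewrite scaler0 addr0.
exists (linear_pack zl); apply: inj_surj_bij => [u v _|f].
  by apply/rowP => -[].
by exists 0; rewrite (h0 f).
Qed.

Lemma hdim_isor P X Y : isomorphic X Y -> hdim P X = hdim P Y.
Proof.
move=> [f [g [gf fg]]]; apply/eqP; rewrite eqn_leq.
have fm : mono f by apply: iso_mono; exists g.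
have gm : mono g by apply: iso_mono; exists f.
by rewrite (hdim_mono P fm).1 (hdim_mono P gm).1.
Qed.

(** Not the number of composition factors, but like it additive and positive on nonzero objects,
    which is what inductions and minimality arguments require. *)
Definition len X := hdim G X.

Lemma len_ses X Y Z (i : hom X Y) (q : hom Y Z) :
  short_exact i q -> len Y = (len X + len Z)%N.
Proof. by apply: hdim_ses; exact: fc_proj fcC. Qed.

Lemma len_gt0 X : ~ is_zero X -> (0 < len X)%N.
Proof. by move=> /(fc_gen fcC)[f]; exact: hdim_gt0. Qed.

Lemma len_mono X Y (i : hom X Y) : mono i -> ~ is_iso i -> (len X < len Y)%N.
Proof.
move=> mi ni; have [Q [q ses]] := mono_ses abC mi.
rewrite (len_ses ses) -{1}[len X]addn0 ltn_add2l; apply: len_gt0 => -[_ zQ].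
apply: ni; apply: (mono_epi_iso abC mi); apply/epi0P => T u ui0.
by have [s <-] := cokernel_desc ses.2 ui0; rewrite (zQ _ q) compm0.
Qed.

Lemma len_epi X Y (q : hom X Y) : epi q -> ~ is_iso q -> (len Y < len X)%N.
Proof.
move=> eq ni; have [K [i ses]] := epi_ses abC eq.
rewrite (len_ses ses) -{1}[len Y]add0n ltn_add2r; apply: len_gt0 => -[zK _].
apply: ni; apply: (mono_epi_iso abC _ eq); apply/mono0P => T u qu0.
by have [s <-] := kernel_lift ses.1 qu0; rewrite (zK _ i) comp0m.
Qed.

Lemma nonsimple_ses X : ~ is_zero X -> ~ simple X ->
  exists T Q (i : hom T X) (q : hom X Q),
    [/\ short_exact i q, ~ is_zero T & ~ is_zero Q].
Proof.
move=> nzX nsX; apply: contrapT => none; apply: nsX; split=> // T m mm.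
apply: contrapT => /not_orP[nzT nim]; apply: none.
have [Q [q ses]] := mono_ses abC mm; exists T, Q, m, q; split=> // -[_ zQ].
apply: nim; apply: (mono_epi_iso abC mm); apply/epi0P => U u ui0.
by have [s <-] := cokernel_desc ses.2 ui0; rewrite (zQ _ q) compm0.
Qed.

Lemma simple_quotient X : ~ is_zero X ->
  exists S (q : hom X S), simple S /\ epi q.
Proof.
have [n] := ubnP (len X); elim: n X => // n IH X leX nzX.
have [sX|nsX] := pselect (simple X); first by exists X, (idm X); split=> //; exact/iso_epi/iso_id.
have [T [Q [i [q [ses nzT nzQ]]]]] := nonsimple_ses nzX nsX.
have lT := len_gt0 nzT; have eX := len_ses ses.
have [S [p [sS ep]]] := IH Q ltac:(lia) nzQ.
by exists S, (p \oc q); split=> //; apply: epi_comp => //; exact: cokernel_epi ses.2.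
Qed.

Lemma simple_sub X : ~ is_zero X ->
  exists S (i : hom S X), simple S /\ mono i.
Proof.
have [n] := ubnP (len X); elim: n X => // n IH X leX nzX.
have [sX|nsX] := pselect (simple X); first by exists X, (idm X); split=> //; exact/iso_mono/iso_id.
have [T [Q [i [q [ses nzT nzQ]]]]] := nonsimple_ses nzX nsX.
have lQ := len_gt0 nzQ; have eX := len_ses ses.
have [S [p [sS ep]]] := IH T ltac:(lia) nzT.
by exists S, (i \oc p); split=> //; apply: mono_comp => //; exact: kernel_mono ses.1.
Qed.

Lemma composition_series_exists X : exists s, composition_series X s.
Proof.
have [n] := ubnP (len X); elim: n X => // n IH X leX.
have [zX|nzX] := pselect (is_zero X); first by exists [::]; exact: Comp_nil.
have [S [q [sS eq]]] := simple_quotient nzX.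
have [Y [i ses]] := epi_ses abC eq.
have lS := len_gt0 sS.1; have eX := len_ses ses.
have [s sY] := IH Y ltac:(lia).
by exists (S :: s); exact: Comp_cons ses sS sY.
Qed.

Lemma length_ind (Pr : C -> Prop) : (forall X, is_zero X -> Pr X) ->
  (forall X Y S (i : hom Y X) (q : hom X S), short_exact i q -> simple S ->
    Pr Y -> Pr X) -> forall X, Pr X.
Proof.
move=> Pr0 PrS X; have [s] := composition_series_exists X.
by elim=> [{}X|{}X Y S {}s i q ses sS _ PrY]; [exact: Pr0 | exact: PrS ses sS PrY].
Qed.

(* If a projective [e : P -> S] is not a cover, some [psi] with [e psi = e] is not
   epic; if its image has least possible length, it is a retract of [P], hence a
   smaller projective over [S]. *)
Lemma projective_cover_exists S : simple S -> exists P, projective_cover P S.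
Proof.
move=> sS; have [e0 e0n0] := fc_gen fcC sS.1.
have ee0 := to_simple_epi abC sS e0n0.
suff step m P (e : hom P S) : epi e -> projective P -> (len P < m)%N ->
    exists P, projective_cover P S.
  exact: (step (len G).+1 G e0 ee0 (fc_proj fcC) (leqnn _)).
elim: m P e => // m IH P e ee prP leP.
have [cov|ncov] := pselect (forall T (g : hom T P), epi (e \oc g) -> epi g).
  by exists P; split=> //; exists e.
pose A l := `[< exists psi : hom P P, e \oc psi = e /\
  exists I (p : hom P I) (j : hom I P), [/\ epi p, mono j, psi = j \oc p & len I = l] >].
have [T [g [eeg neg]]] : exists T (g : hom T P), epi (e \oc g) /\ ~ epi g.
  apply: contrapT => h; apply: ncov => T g eeg; apply: contrapT => neg.
  by apply: h; exists T, g.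
have [h hP] := prP _ _ _ e eeg.
have [I0 [p0 [j0 [ep0 mj0 gh]]]] := image abC (g \oc h).
have AI0 : A (len I0).
  apply/asboolP; exists (g \oc h); split; first by rewrite compA.
  by exists I0, p0, j0.
have ltI0 : (len I0 < len P)%N.
  apply: (len_mono mj0) => /iso_epi ej0; apply: neg; apply: (@epi_compr _ _ _ _ _ g h).
  by rewrite gh; exact: epi_comp.
have exA : exists l, A l by exists (len I0).
have [l /asboolP[psi [epsi [I [p [j [ep mj psiE lI]]]]]] lmin] := ex_minnP exA.
(* [psi \oc psi] also fixes [e], and its image is that of [p \oc j]. Minimality makes [p \oc j]
   invertible, so [j] splits. *)
have [J [p1 [j1 [ep1 mj1 pj]]]] := image abC (p \oc j).
have lJ : (len I <= len J)%N.
  rewrite lI; apply: lmin; apply/asboolP; exists (psi \oc psi); split.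
    by rewrite compA !epsi.
  exists J, (p1 \oc p), (j \oc j1); split=> //; [exact: epi_comp|exact: mono_comp|].
  by rewrite psiE -!compA (compA p) pj -!compA.
have ip1 : is_iso p1.
  apply: contrapT => /(len_epi ep1); by rewrite ltnNge lJ.
have ij1 : is_iso j1.
  apply: contrapT => /(len_mono mj1); rewrite ltnNge.
  have [r [rp pr]] := ip1.
  by rewrite /len (hdim_isor G (Y := J)) ?leqnn //; exists p1.
have [r [rpj pjr]] : is_iso (p \oc j) by rewrite pj; exact: iso_comp.
have prI : projective I by apply: (@projective_retract _ _ _ _ j (r \oc p)) prP; rewrite -compA.
apply: (IH I (e \oc j)) => //.
  by apply: (@epi_compr _ _ _ _ _ _ p); rewrite -compA -psiE epsi.
have := lmin _ AI0; lia.
Qed.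

Lemma simple_factor X S s (f : hom X S) : simple S -> composition_series X s ->
  f <> 0 -> has (fun T => `[< isomorphic S T >]) s.
Proof.
move=> sS cX; elim: cX f => [{}X [zX _] f f0|{}X Y T {}s i q ses sT _ IH f f0] /=.
  by case: f0; exact: zX.
have [fi0|fi0] := pselect (f \oc i = 0); last by rewrite (IH _ fi0) orbT.
have [h hq] := cokernel_desc ses.2 fi0.
apply/orP; left; apply/asboolP; apply: isomorphic_sym; exists h.
by apply: schur => // h0; apply: f0; rewrite -hq h0 comp0m.
Qed.

Lemma distinct_representatives (s : seq C) : all (fun S => `[< simple S >]) s ->
  exists n (L : 'I_n -> C), [/\ forall i, simple (L i),
    forall i j, isomorphic (L i) (L j) -> i = j
  & forall S, has (fun T => `[< isomorphic S T >]) s -> exists i, isomorphic S (L i)].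
Proof.
elim: s => [_|T s IH /= /andP[/asboolP sT /IH[n [L [sL uL cL]]]]].
  by exists 0%N, (fun i : 'I_0 => G); split=> [[]|[]|].
have [[i iT]|nT] := pselect (exists i, isomorphic T (L i)).
  exists n, L; split=> // S /orP[/asboolP ST|/cL //].
  by exists i; exact: isomorphic_trans iT.
exists n.+1, (fun i => oapp L T (unlift ord0 i)); split=> [i|i j|S /orP[/asboolP ST|/cL[i Si]]].
- by case: (unliftP ord0 i) => [i' _|_] /=.
- case: (unliftP ord0 i) => [i' ->|->]; case: (unliftP ord0 j) => [j' ->|->] //=.
  + by move=> /uL ->.
  + by move=> /isomorphic_sym ij; case: nT; exists i'.
  + by move=> ij; case: nT; exists j'.
- by exists ord0; rewrite unlift_none.
- by exists (lift ord0 i); rewrite liftK.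
Qed.

(** Every simple object receives a nonzero map from [G], hence occurs in one fixed composition
    series of [G]. *)
Lemma simple_representatives_exist : exists n (L : 'I_n -> C), simple_representatives L.
Proof.
have [s sG] := composition_series_exists G.
have sall : all (fun S => `[< simple S >]) s.
  by elim: sG => //= X Y S {}s i q _ sS _ ->; rewrite andbT; exact/asboolP.
have [n [L [sL uL cL]]] := distinct_representatives sall.
exists n, L; split=> // S sS; apply: cL.
by have [f f0] := fc_gen fcC sS.1; exact: simple_factor sG f0.
Qed.

End FiniteLength.

(** * Multiplicities *)

Section Multiplicity.
Variables (k : closedFieldType) (C : kcat k) (G : C) (fcC : fincat G).
Implicit Types X Y Z T S P : C.
Let abC : abelian C := fcC.

Lemma operator_eigenvector (V : lmodType k) n (g : V -> V) : has_dim V n -> (0 < n)%N ->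
  linear g -> exists c v, v <> 0 /\ g v = c *: v.
Proof.
move=> [h [h' hK h'K]] n0 gl.
have al : linear (fun v => h' (g (h v))).
  move=> a u v; apply: (can_inj hK); rewrite h'K !linearP /= gl.
  by rewrite !h'K.
pose A := lin1_mx (linear_pack al).
have [c cA] : exists c, root (char_poly A) c.
  by apply/closed_rootP; rewrite size_char_poly; case: n n0 {h h' hK h'K al A}.
have /eigenvalueP[v vA v0] : eigenvalue A c by rewrite eigenvalue_root_char.
exists c, (h v); split.
  by move=> hv0; move/eqP: v0; apply; apply: (can_inj hK); rewrite hv0 linear0.
by move: vA; rewrite mul_rV_lin1 /= => vA; rewrite -[LHS]h'K vA linearZ.
Qed.

(** Composition with [f] on [Hom (S, S)] has an eigenvector [g] because [k] is algebraically closed;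
    [f - c] kills the nonzero [g], so it is not a monomorphism and must vanish. *)
Lemma schur_scalar S (f : hom S S) : simple S -> exists c, f = c *: idm S.
Proof.
move=> sS; have id0 : idm S <> 0 by move/zeroP; case: sS.
have [|c [g [g0 fg]]] := operator_eigenvector (g := fun g : hom S S => f \oc g)
    (hdimP fcC S S) (hdim_gt0 fcC id0).
  by move=> a u v; rewrite comp_linr.
exists c; apply/eqP; rewrite -subr_eq0; apply/eqP; apply: contrapT => fc0.
have /mono0P/(_ S g) := from_simple_mono abC sS fc0.
by rewrite compBl compZl comp1m fg subrr => /(_ erefl).
Qed.

Section Cover.
Variables (P L : C) (sL : simple L) (cov : projective_cover P L).

(** If [e] were nonzero on the kernel of [f], that kernel would map onto [L], hence onto [P] since
    the cover is essential, and [f] would vanish. So [e] factors through [f]. *)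
Lemma cover_simple_hom S (f : hom P S) : simple S -> f <> 0 -> isomorphic S L.
Proof.
move=> sS f0; have [prP [e [ee ess]]] := cov.
have ef := to_simple_epi abC sS f0.
have [K [i ses]] := epi_ses abC ef.
have [ei0|ei0] := pselect (e \oc i = 0).
  have [h hf] := cokernel_desc ses.2 ei0; exists h; apply: schur => // h0.
  by apply: (sL.1); apply: (epi_zero ee); rewrite -hf h0 comp0m.
have ei := ess _ i (to_simple_epi abC sL ei0).
by case: f0; move/epi0P: ei; apply; exact: ses.1.1.
Qed.

(** Essentiality of the cover forces every [g] to kill the kernel of [e1], so [g] factors through
    [e1], and Schur's lemma makes the factor a scalar. *)
Lemma cover_hom_scalar (e : hom P L) (f : hom P L) : e <> 0 ->
  exists c, f = c *: e.
Proof.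
move=> e0; have [prP [e1 [ee1 ess]]] := cov.
have scal (g : hom P L) : exists c, g = c *: e1.
  have [->|g0] := pselect (g = 0); first by exists 0; rewrite scale0r.
  have [K [i ses]] := epi_ses abC ee1.
  have [gi0|gi0] := pselect (g \oc i = 0).
    have [h <-] := cokernel_desc ses.2 gi0; have [c ->] := schur_scalar h sL.
    by exists c; rewrite compZl comp1m.
  have [K' [i' ses']] := epi_ses abC (to_simple_epi abC sL g0).
  have [ei0|ei0] := pselect (e1 \oc i' = 0).
    have [h he] := cokernel_desc ses'.2 ei0; have [c cE] := schur_scalar h sL.
    case: gi0; have : h \oc (g \oc i) = 0 by rewrite compA he ses.1.1.
    rewrite cE compZl comp1m => /eqP; rewrite scaler_eq0 => /orP[/eqP c0|/eqP //].
    case: (sL.1); apply: (epi_zero ee1).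
    by rewrite -he cE c0 scale0r comp0m.
  have ei := ess _ i' (to_simple_epi abC sL ei0).
  by case: g0; move/epi0P: ei; apply; exact: ses'.1.1.
have [a aE] := scal e; have [b ->] := scal f.
have a0 : a != 0 by apply/eqP => a0; apply: e0; rewrite aE a0 scale0r.
by exists (b / a); rewrite aE scalerA divfK.
Qed.

Lemma cover_epi : exists e : hom P L, epi e /\ e <> 0.
Proof.
have [prP [e [ee ess]]] := cov; exists e; split=> // e0.
by apply: (sL.1); exact: epi_zero e0.
Qed.

Lemma hdim_cover_self : hdim P L = 1%N.
Proof.
have [e [_ e0]] := cover_epi.
apply: (@has_dim_uniq _ (hom P L) _ _ (hdimP fcC P L)).
have hl : linear (fun c : 'rV[k]_1 => c 0 0 *: e).
  by move=> a u v; rewrite !mxE scalerDl scalerA.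
exists (linear_pack hl); apply: inj_surj_bij => [|f].
  apply: linear_inj => // c /= /eqP; rewrite scaler_eq0 => /orP[/eqP c0|/eqP //].
  by apply/rowP => i; rewrite ord1 c0 mxE.
by have [c ->] := cover_hom_scalar f e0; exists c%:M; rewrite /= !mxE eqxx.
Qed.

Lemma hdim_cover_simple S : simple S -> hdim P S = `[< isomorphic S L >] :> nat.
Proof.
move=> sS; case: asboolP => [SL|nSL]; first by rewrite (hdim_isor fcC P SL) hdim_cover_self.
by apply: (hdim0 fcC) => f; apply: contrapT => /(cover_simple_hom sS).
Qed.

(** [hdim P] is additive, 1 on [L] and 0 on the other simple objects. The right-hand side does not
    mention [s], which gives the Jordan-Hoelder independence behind [multiplicity]. *)
Lemma count_factors X s : composition_series X s ->
  count (fun S => `[< isomorphic S L >]) s = hdim P X.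
Proof.
elim=> [{}X zX|{}X Y S {}s i q ses sS _ IH] /=.
  by rewrite (hdim0 fcC) // => f; exact: zX.2.
by rewrite (hdim_ses fcC cov.1 ses) -IH hdim_cover_simple // addnC.
Qed.

Lemma multiplicityE X : multiplicity X L = hdim P X.
Proof.
rewrite /multiplicity; case: xgetP => [m _ [s sX <-]|none]; first exact: count_factors.
have [s sX] := composition_series_exists fcC X.
by case: (none (count (fun S => `[< isomorphic S L >]) s)); exists s.
Qed.

End Cover.

Section Additive.
Variables (R : zmodType) (phi : C -> R).
Definition additive_on := forall X Y Z (i : hom X Y) (q : hom Y Z),
  short_exact i q -> phi Y = phi X + phi Z.
Hypothesis phiP : additive_on.

Lemma additive_zero X : is_zero X -> phi X = 0.
Proof.
move=> zX; have := phiP (iso_ses abC zX (iso_id X)).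
by rewrite -{1}[phi X]addr0 => /addrI.
Qed.

Lemma additive_iso X Y : isomorphic X Y -> phi X = phi Y.
Proof.
move=> [f fi]; have [Z zZ] := ab_zero abC.
by rewrite (phiP (iso_ses abC zZ fi)) (additive_zero zZ) add0r.
Qed.

Variables (n : nat) (L P : 'I_n -> C) (Lrep : simple_representatives L)
  (Pcov : forall i, projective_cover (P i) (L i)).

(** This replaces the Grothendieck group, which is never formed: the class of [X] enters through its
    coordinates [hdim (P i) X]. *)
Lemma additiveE X : phi X = \sum_i phi (L i) *+ hdim (P i) X.
Proof.
have [sL uL cL] := Lrep; elim/(length_ind fcC): X => [X zX|X Y S i q ses sS IH].
  rewrite additive_zero // big1 // => i _; rewrite (hdim0 fcC) // => f; exact: zX.2.
rewrite (phiP ses) IH; have [j Sj] := cL _ sS; rewrite (additive_iso Sj).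
transitivity (\sum_i0 phi (L i0) *+ hdim (P i0) Y +
    \sum_i0 phi (L i0) *+ hdim (P i0) S).
  congr (_ + _); rewrite (bigD1 j) //= big1 ?addr0 => [|l lj].
    rewrite (hdim_cover_simple (sL j) (Pcov j) sS) (_ : `[< _ >] = true) //.
    exact/asboolP.
  rewrite (hdim_cover_simple (sL l) (Pcov l) sS) (_ : `[< _ >] = false) //.
  apply/asboolP => Sl; move/eqP: lj; apply; apply: uL.
  by apply: isomorphic_trans Sj; exact: isomorphic_sym.
rewrite -big_split /=; apply: eq_bigr => l _.
by rewrite (hdim_ses fcC (Pcov l).1 ses) mulrnDr.
Qed.

End Additive.

End Multiplicity.

(** * Exactness of the tensor product *)

Section Tensor.
Variables (k : fieldType) (C : moncat k).
Implicit Types X Y Z T : C.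

Lemma tens_compl X X' X'' Y (f : hom X X') (f' : hom X' X'') :
  (f' \oc f) \oxm idm Y = (f' \oxm idm Y) \oc (f \oxm idm Y).
Proof. by rewrite -tensM comp1m. Qed.

Lemma tens_compr X Y Y' Y'' (f : hom Y Y') (f' : hom Y' Y'') :
  idm X \oxm (f' \oc f) = (idm X \oxm f') \oc (idm X \oxm f).
Proof. by rewrite -tensM comp1m. Qed.

Lemma tens_lr X X' Y Y' (f : hom X X') (g : hom Y Y') :
  f \oxm g = (f \oxm idm Y') \oc (idm X \oxm g).
Proof. by rewrite -tensM comp1m compm1. Qed.

Lemma tens_rl X X' Y Y' (f : hom X X') (g : hom Y Y') :
  f \oxm g = (idm X' \oxm g) \oc (f \oxm idm Y).
Proof. by rewrite -tensM comp1m compm1. Qed.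

Program Definition tensL X : kfunctor C C :=
  @KFunctor k C C (fun Y => X \ox Y) (fun _ _ f => idm X \oxm f) _ _ _.
Next Obligation. by move=> X Y Z a f g /=; rewrite tens_linr. Qed.
Next Obligation. by move=> X Y /=; rewrite tens1. Qed.
Next Obligation. by move=> X * /=; rewrite tens_compr. Qed.

Lemma tens0r X Y Z : idm X \oxm (0 : hom Y Z) = 0.
Proof. exact: (fmap0 (tensL X)). Qed.

Lemma assoc_iso X Y Z : is_iso (assoc X Y Z).
Proof. by exists (associ X Y Z); rewrite assocK associK. Qed.

Lemma tens_iso X X' Y Y' (f : hom X X') (g : hom Y Y') :
  is_iso f -> is_iso g -> is_iso (f \oxm g).
Proof.
move=> [f' [f'f ff']] [g' [g'g gg']]; exists (f' \oxm g').
by rewrite -!tensM f'f g'g ff' gg' !tens1.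
Qed.

Lemma associ_natural X X' Y Y' Z Z' (f : hom X X') (g : hom Y Y') (h : hom Z Z') :
  associ X' Y' Z' \oc (f \oxm (g \oxm h)) = ((f \oxm g) \oxm h) \oc associ X Y Z.
Proof.
rewrite -[LHS]compm1 -(associK X Y Z) -!compA (compA (f \oxm _)) -assoc_natural.
by rewrite !compA assocK comp1m.
Qed.

Lemma tens_unit_inj X Y (f g : hom X Y) :
  idm (unitob C) \oxm f = idm (unitob C) \oxm g -> f = g.
Proof.
move=> fg; apply: (iso_epi (lunit_iso X)).
by rewrite -!lunit_natural fg.
Qed.

(* Kelly: this coherence follows from the pentagon and the triangle. *)
Lemma lunit_tens X Y : lunit (X \ox Y) \oc assoc (unitob C) X Y = lunit X \oxm idm Y.
Proof.
apply: tens_unit_inj; set I := unitob C.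
apply: (iso_epi (assoc_iso I (I \ox X) Y)).
apply: (iso_epi (tens_iso (assoc_iso I I X) (iso_id Y))).
rewrite tens_compr -!compA (compA (_ \oxm assoc I X Y)) -pentagon compA triangle.
rewrite -(tens1 X Y) -assoc_natural -triangle (tens_compl Y).
by rewrite !compA -assoc_natural.
Qed.

Lemma pentagon_associ X Y Z T :
  associ X Y (Z \ox T) \oc (idm X \oxm assoc Y Z T) \oc assoc X (Y \ox Z) T =
  assoc (X \ox Y) Z T \oc (associ X Y Z \oxm idm T).
Proof.
apply: (iso_epi (tens_iso (assoc_iso X Y Z) (iso_id T))).
rewrite -[RHS]compA -tens_compl assocK tens1 compm1 -!compA (compA (_ \oxm _)).
by rewrite -pentagon compA assocK comp1m.
Qed.

(** * The adjunction given by a dual pair *)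

Section Dual.
Variables (X' X : C) (ev : hom (X' \ox X) (unitob C)) (coev : hom (unitob C) (X \ox X')).
Hypotheses
  (zig1 : runit X \oc (idm X \oxm ev) \oc assoc X X' X \oc (coev \oxm idm X) = lunit X)
  (zig2 : lunit X' \oc (ev \oxm idm X') \oc associ X' X X' \oc (idm X' \oxm coev)
      = runit X').

(** Counit and unit of the adjunction with left adjoint [X' \ox -] and right adjoint [X \ox -]. The
    unit starts at [unitob C \ox Y], so that no inverse of [lunit] appears. *)
Definition dual_counit Y : hom (X' \ox (X \ox Y)) Y :=
  lunit Y \oc (ev \oxm idm Y) \oc associ X' X Y.
Definition dual_unit Y : hom (unitob C \ox Y) (X \ox (X' \ox Y)) :=
  assoc X X' Y \oc (coev \oxm idm Y).

Lemma dual_counit_natural Y Z (f : hom Y Z) :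
  dual_counit Z \oc (idm X' \oxm (idm X \oxm f)) = f \oc dual_counit Y.
Proof.
rewrite /dual_counit -compA associ_natural tens1 compA -(compA _ (ev \oxm _)).
by rewrite -tens_lr tens_rl !compA lunit_natural.
Qed.

Lemma dual_unit_natural Y Z (f : hom Y Z) :
  (idm X \oxm (idm X' \oxm f)) \oc dual_unit Y = dual_unit Z \oc (idm _ \oxm f).
Proof.
rewrite /dual_unit compA -assoc_natural tens1 -!compA; congr (_ \oc _).
by rewrite -tens_rl tens_lr.
Qed.

Lemma dual_triangle1 Y :
  (idm X \oxm dual_counit Y) \oc dual_unit (X \ox Y) = lunit (X \ox Y).
Proof.
apply: (iso_epi (assoc_iso (unitob C) X Y)); rewrite lunit_tens -zig1.
rewrite /dual_unit /dual_counit !tens_compl !tens_compr -!compA.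
rewrite -(tens1 X Y) -assoc_natural !(compA (assoc X X' _)) pentagon -triangle.
rewrite !(compA (idm X \oxm associ _ _ _)) -tens_compr assocK tens1 comp1m.
by rewrite !compA -(compA _ (assoc X (unitob C) Y)) assoc_natural !compA.
Qed.

Lemma dual_triangle2 Y :
  dual_counit (X' \ox Y) \oc (idm X' \oxm dual_unit Y) = idm X' \oxm lunit Y.
Proof.
apply: (iso_epi (assoc_iso X' (unitob C) Y)); rewrite triangle -zig2.
rewrite /dual_unit /dual_counit !tens_compl !tens_compr -!compA.
rewrite -assoc_natural !(compA (idm X' \oxm assoc _ _ _)) !(compA (associ _ _ _)).
rewrite pentagon_associ -lunit_tens -!compA; congr (_ \oc _).
by rewrite !compA assoc_natural tens1.
Qed.

(** Right adjoints preserve kernels: under [transp], a map into [X \ox Y] killed by [idm X \oxm f]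
    becomes a map into [Y] killed by [f], which factors through [i]. *)
Lemma tensL_kernel_dual Y Z K (f : hom Y Z) (i : hom K Y) :
  is_kernel f i -> is_kernel (idm X \oxm f) (idm X \oxm i).
Proof.
move=> kfi; have mi := kernel_mono kfi.
pose transp T U (t : hom T (X \ox U)) := dual_counit U \oc (idm X' \oxm t).
have transpK T U (t : hom T (X \ox U)) :
    (idm X \oxm transp T U t) \oc dual_unit T = t \oc lunit T.
  by rewrite tens_compr -compA dual_unit_natural compA dual_triangle1 lunit_natural.
have transp_nat T U V (h : hom U V) (t : hom T (X \ox U)) :
    transp T V ((idm X \oxm h) \oc t) = h \oc transp T U t.
  by rewrite /transp tens_compr compA dual_counit_natural -compA.
apply: kernelI.
- apply/mono0P => T u iu0; apply: (iso_epi (lunit_iso T)); rewrite comp0m -transpK.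
  suff -> : transp _ _ u = 0 by rewrite tens0r comp0m.
  by apply: mi; rewrite -transp_nat iu0 /transp tens0r !compm0.
- by rewrite -tens_compr kfi.1 tens0r.
move=> T t ft0; have [l' [_ ll']] := lunit_iso T.
have [s sP] : exists s, i \oc s = transp _ _ t.
  by apply: (kernel_lift kfi); rewrite -transp_nat ft0 /transp tens0r compm0.
exists ((idm X \oxm s) \oc dual_unit T \oc l').
by rewrite compA (compA (idm X \oxm i)) -tens_compr sP transpK -compA ll' compm1.
Qed.

Lemma tensL_cokernel_dual Y Z Q (f : hom Y Z) (q : hom Z Q) :
  is_cokernel f q -> is_cokernel (idm X' \oxm f) (idm X' \oxm q).
Proof.
move=> cfq; have eq := cokernel_epi cfq.
pose transp U T (t : hom (X' \ox U) T) := (idm X \oxm t) \oc dual_unit U.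
have transpK U T (t : hom (X' \ox U) T) :
    dual_counit T \oc (idm X' \oxm transp U T t) = t \oc (idm X' \oxm lunit U).
  by rewrite tens_compr compA dual_counit_natural -compA dual_triangle2.
have transp_nat U V T (h : hom U V) (t : hom (X' \ox V) T) :
    transp U T (t \oc (idm X' \oxm h)) = transp V T t \oc (idm _ \oxm h).
  by rewrite /transp tens_compr -[LHS]compA -[RHS]compA dual_unit_natural.
have lunit_epi U : epi (idm X' \oxm lunit U).
  by apply: iso_epi; apply: tens_iso; [exact: iso_id | exact: lunit_iso].
apply: cokernelI.
- apply/epi0P => T u uq0; apply: lunit_epi; rewrite comp0m -transpK.
  suff -> : transp _ _ u = 0 by rewrite tens0r compm0.
  have [l' [l'l ll']] := lunit_iso Q.
  apply: (iso_epi (_ : is_iso l')); first by exists (lunit Q).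
  apply: eq; rewrite comp0m -[LHS]compA.
  have [m' [m'm mm']] := lunit_iso Z.
  have -> : l' \oc q = (idm _ \oxm q) \oc m'.
    apply: (iso_mono (lunit_iso Q)).
    by rewrite !compA ll' comp1m lunit_natural -compA mm' compm1.
  by rewrite compA -transp_nat uq0 /transp tens0r !comp0m.
- by rewrite -tens_compr cfq.1 tens0r.
move=> T t tf0; have [m' [m'm mm']] := lunit_iso Z.
have [s sP] : exists s, s \oc q = transp _ _ t \oc m'.
  apply: (cokernel_desc cfq); apply: (iso_epi (lunit_iso Y)).
  rewrite -(compA _ f) -lunit_natural (compA _ (lunit Z)) -(compA _ m') m'm compm1.
  by rewrite -transp_nat tf0 /transp tens0r !comp0m.
exists (dual_counit T \oc (idm X' \oxm s)).
apply: lunit_epi; rewrite -[RHS]transpK -(compA (dual_counit T)) -tens_compr.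
by rewrite -(compA (dual_counit T)) -tens_compr sP -(compA _ m') m'm compm1.
Qed.

(** The second zig-zag identity recovers [u] from its transpose. In [unit_simple] this makes the
    dual [i'] of a monomorphism [i] epic. *)
Lemma coev_transpose_inj T (u : hom X' T) :
  (idm X \oxm u) \oc coev = 0 -> u = 0.
Proof.
move=> uc0; apply: (iso_epi (runit_iso X')); rewrite comp0m -zig2 !compA.
rewrite -lunit_natural -(compA _ _ (ev \oxm _)) -tens_rl tens_lr -(tens1 X' X).
rewrite -!compA (compA _ (associ _ _ _)) -associ_natural -(compA (associ _ _ _)).
by rewrite -tens_compr uc0 tens0r !compm0.
Qed.

End Dual.
End Tensor.

Section Reverse.
Variable k : fieldType.

(** Reversing the tensor product exchanges left and right duals, so each statement on [X \ox -]
    yields the one on [- \ox X]. *)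
Program Definition rev_mon (C : moncat k) : moncat k :=
  @MonCat k C (fun X Y => Y \ox X) (fun _ _ _ _ f g => g \oxm f) _ _ _ _
    (unitob C) (fun X Y Z => associ Z Y X) (fun X Y Z => assoc Z Y X)
    (fun X => runit X) (fun X => lunit X) _ _ _ _ _ _ _ _ _.
Next Obligation. by move=> C * /=; rewrite tens1. Qed.
Next Obligation. by move=> C * /=; rewrite tensM. Qed.
Next Obligation. by move=> C * /=; rewrite tens_linr. Qed.
Next Obligation. by move=> C * /=; rewrite tens_linl. Qed.
Next Obligation. by move=> C * /=; rewrite associK. Qed.
Next Obligation. by move=> C * /=; rewrite assocK. Qed.
Next Obligation. by move=> C *; exact: runit_iso. Qed.
Next Obligation. by move=> C *; exact: lunit_iso. Qed.
Next Obligation. by move=> C * /=; rewrite associ_natural. Qed.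
Next Obligation. by move=> C * /=; rewrite runit_natural. Qed.
Next Obligation. by move=> C * /=; rewrite lunit_natural. Qed.
Next Obligation.
move=> C X Y Z T /=.
apply: (iso_epi (assoc_iso T Z (Y \ox X))).
apply: (iso_epi (assoc_iso (T \ox Z) Y X)).
rewrite -!compA (compA (associ T Z _)) assocK comp1m assocK pentagon.
rewrite (compA (idm T \oxm _)) -!compA !(compA (idm T \oxm associ _ _ _)).
rewrite -tens_compr assocK tens1 comp1m (compA (associ T _ X)) assocK comp1m.
by rewrite -tens_compl assocK tens1.
Qed.
Next Obligation.
move=> C X Y /=; rewrite -triangle -compA associK compm1 //.
Qed.

Lemma left_dual_rev (C : moncat k) (X X' : C) :
  left_dual X' X -> @left_dual k (rev_mon C) X X'.
Proof. by move=> [ev [coev [z1 z2]]]; exists ev, coev. Qed.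

Lemma rigid_rev (C : moncat k) : rigid C -> rigid (rev_mon C).
Proof.
by move=> rC X; have [[X1 d1] [X2 d2]] := rC X; split;
  [exists X2 | exists X1]; exact: left_dual_rev.
Qed.

End Reverse.

Section Rigid.
Variables (k : fieldType) (C : moncat k) (rC : rigid C).
Implicit Types X Y Z : C.

(** A left dual makes [X \ox -] a right adjoint, which preserves kernels; a right dual makes it a
    left adjoint, which preserves cokernels. *)
Lemma tensL_exact X : exact_functor (tensL X).
Proof.
move=> Y Z T i q [kq ci]; have [[X1 [ev [coev [z1 z2]]]] [X2 [ev2 [coev2 [z3 z4]]]]] := rC X.
split; first exact: tensL_kernel_dual z1 _ _ _ _ _ kq.
exact: tensL_cokernel_dual z4 _ _ _ _ _ ci.
Qed.

End Rigid.

Section Rigid2.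
Variables (k : fieldType) (C : moncat k) (rC : rigid C).
Implicit Types X Y Z : C.

Program Definition tensR X : kfunctor C C :=
  @KFunctor k C C (fun Y => Y \ox X) (fun _ _ f => f \oxm idm X) _ _ _.
Next Obligation. by move=> X Y Z a f g /=; rewrite tens_linl. Qed.
Next Obligation. by move=> X Y /=; rewrite tens1. Qed.
Next Obligation. by move=> X * /=; rewrite tens_compl. Qed.

Lemma tensR_exact X : exact_functor (tensR X).
Proof. exact: (@tensL_exact k (rev_mon C) (rigid_rev rC) X). Qed.

Hypothesis abC : abelian C.

Lemma tens_mono X X' Y Y' (f : hom X X') (g : hom Y Y') :
  mono f -> mono g -> mono (f \oxm g).
Proof.
move=> mf mg; rewrite tens_lr; apply: mono_comp.
  exact: (fmap_mono abC (tensR_exact Y') mf).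
exact: (fmap_mono abC (tensL_exact rC X) mg).
Qed.

Lemma coev_neq0 X X' (ev : hom (X' \ox X) (unitob C)) (coev : hom (unitob C) (X \ox X')) :
  runit X \oc (idm X \oxm ev) \oc assoc X X' X \oc (coev \oxm idm X) = lunit X ->
  coev = 0 -> is_zero X.
Proof.
move=> zig c0; apply: (epi_zero (iso_epi (lunit_iso X))).
by rewrite -zig c0 [0 \oxm _](fmap0 (tensR X)) compm0.
Qed.

Variables (G : C) (fcC : fincat G).
Hypothesis end_unit : bijective (fun a : k => a *: idm (unitob C)).

Lemma unit_nonzero : ~ is_zero (unitob C).
Proof.
move=> /zeroP id0; have := bij_inj end_unit (x1 := 1) (x2 := 0).
by rewrite id0 !scaler0 => /(_ erefl)/eqP; rewrite oner_eq0.
Qed.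

(* EGNO, Theorem 4.3.8: a simple subobject [i : X -> 1] has epic dual
   [1 -> X'], so [X -> X (x) X'] is an isomorphism and [coev] yields a nonzero,
   hence invertible, endomorphism [1 -> X (x) X' ~ X -> 1]. *)
Lemma unit_simple : simple (unitob C).
Proof.
have [X [i [sX mi]]] := simple_sub fcC unit_nonzero.
have [[X' [ev [coev [z1 z2]]]] _] := rC X.
pose i' := lunit X' \oc (i \oxm idm X') \oc coev.
have ei' : epi i'.
  apply/epi0P => T u; rewrite /i' !compA -lunit_natural -(compA _ _ (i \oxm _)).
  rewrite -tens_rl tens_lr -!compA => h.
  apply: (coev_transpose_inj z2).
  have mm : mono (lunit T \oc (i \oxm idm T)).
    apply: mono_comp; first exact: iso_mono (lunit_iso T).
    by apply: tens_mono => //; exact/iso_mono/iso_id.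
  by apply: mm; rewrite compm0 -!compA.
pose f := (idm X \oxm i') \oc (sval (cid (runit_iso X))).
have ef : epi f.
  apply: epi_comp; first exact: (fmap_epi abC (tensL_exact rC X) ei').
  apply: iso_epi; case: (cid _) => /= r [h1 h2]; by exists (runit X).
have coev0 : coev <> 0 by move=> /(coev_neq0 z1); exact: sX.1.
have f0 : f <> 0.
  move=> f0; apply: coev0; have [_ z] := epi_zero ef f0; exact: z.
have [g [gf fg]] : is_iso f.
  by apply: (mono_epi_iso abC _ ef); exact: (from_simple_mono abC sX f0).
have [c' _ cK] := end_unit.
have := cK (i \oc g \oc coev); move: (c' _) => c cE.
have c0 : c != 0.
  apply/eqP => c0; apply: coev0; have mg : mono (i \oc g).
    by apply: mono_comp => //; apply: iso_mono; exists f.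
  by apply: mg; rewrite -cE c0 scale0r compm0.
have isi : is_iso i.
  apply: (mono_epi_iso abC mi); apply/epi0P => T u ui0.
  have : u \oc (c *: idm _) = 0 by rewrite cE !compA ui0 !comp0m.
  rewrite compZr compm1 => /eqP; rewrite scaler_eq0 (negPf c0) => /eqP //.
by apply: simple_iso sX; exists i.
Qed.

Lemma coev_mono X X' (ev : hom (X' \ox X) (unitob C)) (coev : hom (unitob C) (X \ox X')) :
  runit X \oc (idm X \oxm ev) \oc assoc X X' X \oc (coev \oxm idm X) = lunit X ->
  ~ is_zero X -> mono coev.
Proof.
move=> zig nzX; apply: (from_simple_mono abC unit_simple) => c0.
exact/nzX/(coev_neq0 zig).
Qed.

(** [coev] is a monomorphism since the unit is simple; tensor it with [Y]. The case [Y = unitob C]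
    serves for faithfulness of [F], simple [Y] for the positivity of the matrix in
    [FPdim_weight]. *)
Lemma tens_cogenerates X Y : ~ is_zero X ->
  exists Z (f : hom Y (X \ox Z)), mono f.
Proof.
move=> nzX; have [[X' [ev [coev [z1 z2]]]] _] := rC X.
have [l [h1 h2]] := lunit_iso Y.
exists (X' \ox Y), (assoc X X' Y \oc (coev \oxm idm Y) \oc l).
apply: mono_comp; last by apply: iso_mono; exists (lunit Y).
apply: mono_comp; first exact: iso_mono (assoc_iso _ _ _).
by apply: tens_mono; [exact: coev_mono z1 nzX | exact/iso_mono/iso_id].
Qed.

End Rigid2.

(** * Exact monoidal functors kill no nonzero object *)

Section ExactMonoidal.
Variables (k : fieldType) (C D : moncat k) (F : monfunctor C D).
Hypotheses (abC : abelian C) (rC : rigid C) (exF : exact_functor F).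
Variables (G : C) (fcC : fincat G).
Hypothesis end_unit : bijective (fun a : k => a *: idm (unitob C)).
Hypothesis unitD : ~ is_zero (unitob D).

(** The unit embeds into some [X \ox Z], so the unit of [D] embeds into [F X \ox F Z], which is zero
    when [F X] is. *)
Lemma exact_monoidal_zero (X : C) : is_zero (F X) -> is_zero X.
Proof.
move=> zFX; apply: contrapT => nzX; apply: unitD.
have [Z [f mf]] := tens_cogenerates rC abC fcC end_unit (unitob C) nzX.
apply: zero_sub (iso_mono (mon_unit_iso F)) _.
apply: zero_sub (fmap_mono abC exF mf) _.
apply: isomorphic_zero (ex_intro _ _ (mon_tens_iso F X Z)) _.
exact: (fob_zero (tensR (F Z)) zFX).
Qed.

End ExactMonoidal.

(** * The Perron vector of a positive matrix *)

Section Perron.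
Import numFieldNormedType.Exports.
Local Open Scope classical_set_scope.

Lemma continuous_sum_fun (R : realType) (T : topologicalType) (I : finType)
    (f : I -> T -> R) :
  (forall i, continuous (f i)) -> continuous (fun z => \sum_i f i z).
Proof.
move=> fc; have -> : (fun z => \sum_i f i z) = \sum_i f i.
  by apply/funext => z; rewrite fct_sumE.
apply: (big_ind (fun g : T -> R => continuous g)) => //.
  by move=> z; exact: cst_continuous.
by move=> g h gc hc z; apply: continuousD; [exact: gc | exact: hc].
Qed.

Section PositiveMatrix.
Variables (R : realType) (n : nat) (M : 'I_n.+1 -> 'I_n.+1 -> R).
Hypothesis M_gt0 : forall i j, 0 < M i j.

(* A point of [V] encodes a pair [(r, x)]; the Collatz-Wielandt eigenvalue is the
   largest [r] such that [M x >= r x] for some [x >= 0] with [\sum_i x i = 1]. *)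
Let V := 'rV[R]_(1 + n.+1).
Let ev (z : V) : R := z ord0 (lshift n.+1 ord0).
Let vec (z : V) i : R := z ord0 (rshift 1 i).
Let app (x : 'I_n.+1 -> R) i : R := \sum_j M i j * x j.
(** Bounds every admissible [r], as [feasible] shows; the box of side [bound + 1] also leaves room
    for the coordinates of [x], which are at most 1. *)
Let bound : R := \sum_i \sum_j M i j.

Let A : set V :=
  [set z : V | forall i, `[0, bound + 1]%classic (z ord0 i)] `&`
  ([set z : V | \sum_i vec z i = 1] `&`
   \bigcap_i [set z : V | ev z * vec z i - app (vec z) i <= 0]).

Let cont_coord i : continuous (fun z : V => z ord0 i).
Proof. exact: coord_continuous. Qed.

Let A_compact : compact A.
Proof.
apply: compact_closedI.
  by apply: (@rV_compact _ _ (fun=> `[0, bound + 1]%classic)) => i; exact: segment_compact.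
apply: closedI.
  apply: (@preimage_closed _ _ (fun z : V => \sum_i vec z i) [set x | x = 1]).
    by move=> z _; apply: continuous_sum_fun => i; exact: cont_coord.
  exact: closed_eq.
apply: closed_bigI => i _.
apply: (@preimage_closed _ _ (fun z : V => ev z * vec z i - app (vec z) i) [set x | x <= 0]).
  move=> z _; apply: (@continuousB _ _ _ (fun z : V => ev z * vec z i)
    (fun z : V => app (vec z) i)).
    by apply: continuousM; exact: cont_coord.
  apply: continuous_sum_fun => j {}z; apply: continuousM.
    exact: cst_continuous.
  exact: cont_coord.
exact: closed_le.
Qed.

Let M_sum_gt0 (x : 'I_n.+1 -> R) : (forall i, 0 <= x i) -> (exists i, x i != 0) ->
  forall i, 0 < app x i.
Proof.
move=> x0 [j xj] i; rewrite /app (bigD1 j) //=.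
apply: ltr_wpDr; first by apply: sumr_ge0 => l _; rewrite mulr_ge0 ?x0 // ltW.
by rewrite mulr_gt0 // lt_def xj x0.
Qed.

Let feasible (r : R) (x : 'I_n.+1 -> R) : 0 <= r -> (forall i, 0 <= x i) ->
  \sum_i x i = 1 -> (forall i, r * x i <= app x i) ->
  exists2 z, A z & ev z = r.
Proof.
move=> r0 x0 x1 rx.
have xle1 i : x i <= 1.
  by rewrite -x1 (bigD1 i) //= lerDl sumr_ge0.
have b0 : 0 <= bound by apply: sumr_ge0 => i _; apply: sumr_ge0 => j _; exact: ltW.
have rb : r <= bound.
  rewrite -[r]mulr1 -x1 mulr_sumr; apply: ler_sum => i _; apply: le_trans (rx i) _.
  by apply: ler_sum => j _; rewrite ler_piMr // ltW.
pose z : V := row_mx (\row_(_ < 1) r) (\row_i x i).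
have vz i : vec z i = x i by rewrite /vec row_mxEr mxE.
have ez : ev z = r by rewrite /ev row_mxEl mxE.
exists z => //; split; last split.
- move=> i /=; rewrite in_itv /=; case: (split_ordP i) => j ->.
    by rewrite row_mxEl mxE r0; lra.
  by rewrite row_mxEr mxE x0; have := xle1 j; lra.
- by rewrite /= -[RHS]x1; apply: eq_bigr => i _; rewrite vz.
move=> i _ /=; rewrite subr_le0 ez vz; apply: le_trans (rx i) _.
by rewrite le_eqVlt; apply/orP; left; apply/eqP/eq_bigr => j _; rewrite vz.
Qed.

Theorem perron : exists r (v : 'I_n.+1 -> R),
  [/\ 0 < r, forall i, 0 < v i, forall i, \sum_j M i j * v j = r * v i
    & forall w, (forall i, \sum_j M i j * w j = r * w i) ->
      exists c, forall i, w i = c * v i].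
Proof.
have normalize (r : R) x : 0 <= r -> (forall i, 0 <= x i) -> (exists i, x i != 0) ->
    (forall i, r * x i <= app x i) -> exists2 z, A z & ev z = r.
  move=> r0 x0 [j xj] rx.
  have s0 : 0 < \sum_i x i.
    rewrite (bigD1 j) //=; apply: ltr_wpDr; first exact: sumr_ge0.
    by rewrite lt_def xj x0.
  apply: (feasible (x := fun i => x i / \sum_i x i)) => // [i||i].
  - by rewrite divr_ge0 // ltW.
  - by rewrite -mulr_suml divff // gt_eqF.
  - rewrite mulrA /app; under [X in _ <= X]eq_bigr do rewrite /= mulrA.
    by rewrite -mulr_suml ler_pM2r ?invr_gt0 //; exact: rx.
have [z0 Az0 _] : exists2 z, A z & ev z = 0.
  apply: (normalize 0 (fun=> 1)) => // [|i]; first by exists ord0; rewrite oner_eq0.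
  by rewrite mul0r; apply: sumr_ge0 => j _; rewrite mulr1 ltW.
have [z /set_mem Az zmax] : exists2 c, c \in A & forall t, t \in A -> ev t <= ev c.
  apply: EVT_max_rV => //; first by exists z0.
  by apply: continuous_subspaceT => t; exact: cont_coord.
set r := ev z in zmax; set x := vec z; have [zbox [x1 xr]] := Az.
have r0 : 0 <= r by have := zbox (lshift n.+1 ord0); rewrite /= in_itv => /andP[].
have x0 i : 0 <= x i by have := zbox (rshift 1 i); rewrite /= in_itv => /andP[].
have xn0 : exists i, x i != 0.
  apply: contrapT => h; have := x1; rewrite /= big1 => [/esym/eqP|i _].
    by rewrite oner_eq0.
  by apply/eqP; apply: contrapT => /negP xi; apply: h; exists i.
have rx i : r * x i <= app x i by have := xr i I; rewrite /= subr_le0.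
have ax := M_sum_gt0 x0 xn0.
(* Were [M x - r x] nonzero, its image under [M] would be positive in every coordinate. The least
   relative gain [d] then makes [M x] admissible for [r + d], against the maximality of [r]. *)
have eigen i : app x i = r * x i.
  apply: contrapT => ne.
  have y0 j : 0 <= app x j - r * x j by rewrite subr_ge0.
  have ay : forall l, 0 < app (fun j => app x j - r * x j) l.
    by apply: M_sum_gt0 => //; exists i; rewrite subr_eq0; apply/eqP.
  have appB l : app (fun j => app x j - r * x j) l = app (app x) l - r * app x l.
    rewrite {1}/app; under eq_bigr do rewrite mulrBr mulrCA.
    by rewrite sumrB -mulr_sumr.
  have {}ay l : r * app x l < app (app x) l by rewrite -subr_gt0 -appB.
  pose e l := (app (app x) l - r * app x l) / app x l.
  pose d := e [arg min_(l < ord0) e l]%O.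
  have de l : d <= e l by rewrite /d; case: arg_minP => // m _; apply.
  have d0 : 0 < d by rewrite /d /e divr_gt0 // subr_gt0.
  have [t At te] : exists2 t, A t & ev t = r + d.
    apply: (normalize _ (app x)) => [|l||l]; [by lra|exact: ltW| |].
      by exists ord0; rewrite gt_eqF.
    have := de l; rewrite /e ler_pdivlMr // mulrDl; lra.
  have := zmax t (mem_set At); rewrite te; lra.
have rpos : 0 < r.
  rewrite lt_def r0 andbT; apply/eqP => r00.
  by have := ax ord0; rewrite eigen r00 mul0r ltxx.
have xpos i : 0 < x i by have := ax i; rewrite eigen pmulr_rgt0.
exists r, x; split=> // w wr.
(* Subtracting the least ratio times [x] from [w] leaves a nonnegative eigenvector vanishing at
   [i0]; were it nonzero, positivity of [M] would make it positive there. *)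
pose q i := w i / x i; pose i0 := [arg min_(i < ord0) q i]%O.
have qmin i : q i0 <= q i by rewrite /i0; case: arg_minP => // m _; apply.
exists (q i0) => i; apply/eqP; rewrite -subr_eq0; apply: contrapT => /negP ne.
pose y j := w j - q i0 * x j.
have y0 j : 0 <= y j.
  by rewrite subr_ge0 -ler_pdivlMr //; exact: qmin.
have := M_sum_gt0 y0 (ex_intro _ i ne) i0.
have -> : app y i0 = r * y i0.
  rewrite /app /y; under eq_bigr do rewrite mulrBr mulrCA.
  by rewrite sumrB -mulr_sumr wr -/(app x i0) eigen mulrBr mulrCA.
by rewrite /y /q divfK ?gt_eqF // subrr mulr0 ltxx.
Qed.

End PositiveMatrix.

End Perron.

(** * Frobenius-Perron dimension *)

Lemma perron_ord (R : realType) n (i0 : 'I_n) (M : 'I_n -> 'I_n -> R) :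
  (forall i j, 0 < M i j) -> exists r (v : 'I_n -> R),
  [/\ 0 < r, forall i, 0 < v i, forall i, \sum_j M i j * v j = r * v i
    & forall w, (forall i, \sum_j M i j * w j = r * w i) ->
      exists c, forall i, w i = c * v i].
Proof. by case: n i0 M => [[] //|n _ M]; exact: perron. Qed.

Section PositiveEigenvector.
Variables (R : realType) (n : nat) (i0 : 'I_n) (N : 'M[R]_n) (v : 'I_n -> R) (c : R).
Hypotheses (N_ge0 : forall i j, 0 <= N i j) (v_gt0 : forall i, 0 < v i).
Hypothesis eigen : forall i, \sum_j N i j * v j = c * v i.

Lemma positive_eigenvalue_ge0 : 0 <= c.
Proof.
have := eigen i0; rewrite -(pmulr_lge0 _ (v_gt0 i0)) => <-.
by apply: sumr_ge0 => j _; rewrite mulr_ge0 // ltW.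
Qed.

(** [eigenvalue] refers to row vectors while [eigen] multiplies a column; [N] and its transpose have
    the same characteristic polynomial. *)
Lemma positive_eigenvalue : eigenvalue N c.
Proof.
suff : eigenvalue N^T c.
  rewrite !eigenvalue_root_char /root /char_poly -det_tr.
  congr (_.[_] == _); congr (\det _).
  by apply/matrixP => i j; rewrite !mxE eq_sym.
apply/eigenvalueP; exists (\row_j v j).
  apply/rowP => i; rewrite !mxE -eigen; apply: eq_bigr => j _.
  by rewrite !mxE mulrC.
by apply/eqP => /rowP/(_ i0)/eqP; rewrite !mxE gt_eqF.
Qed.

(** Pairing the absolute value of a row eigenvector [w] with [v] gives [|x| * s <= c * s], where
    [s = \sum_j |w 0 j| * v j] is positive. *)
Lemma positive_eigenvalue_max x : eigenvalue N x -> x <= c.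
Proof.
move=> /eigenvalueP[w wN w0].
have wE j : x * w 0 j = \sum_i w 0 i * N i j.
  by have /rowP/(_ j) := wN; rewrite !mxE.
have s_gt0 : 0 < \sum_j `|w 0 j| * v j.
  have [j wj] : exists j, w 0 j != 0.
    apply: contrapT => h; move/eqP: w0; apply; apply/rowP => j; rewrite mxE.
    by apply/eqP; apply: contrapT => /negP wj; apply: h; exists j.
  rewrite (bigD1 j) //=; apply: ltr_wpDr.
    by apply: sumr_ge0 => i _; rewrite mulr_ge0 // ltW.
  by rewrite mulr_gt0 // normr_gt0.
apply: le_trans (ler_norm x) _; rewrite -(ler_pM2r s_gt0) mulr_sumr.
apply: (@le_trans _ _ (\sum_j (\sum_i `|w 0 i| * N i j) * v j)).
  apply: ler_sum => j _; rewrite mulrA -normrM wE ler_pM2r //.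
  apply: le_trans (ler_norm_sum _ _ _) _.
  by apply: ler_sum => i _; rewrite normrM (ger0_norm (N_ge0 i j)).
under eq_bigr do rewrite mulr_suml.
rewrite exchange_big mulr_sumr; apply: ler_sum => i _ /=.
under eq_bigr do rewrite -mulrA.
by rewrite -mulr_sumr eigen mulrCA.
Qed.

End PositiveEigenvector.

Section FPdimension.
Variables (R : realType) (k : closedFieldType) (C : ftcat k).
Variables (G : C) (fcC : fincat G).
Variables (n : nat) (L P : 'I_n -> C).
Hypotheses (Lrep : simple_representatives L)
  (Pcov : forall i, projective_cover (P i) (L i)).
Implicit Types X Y Z : C.
Let abC : abelian C := fcC.
Let rC : rigid C := @ft_rigid k C.

Lemma hdim_representative i j : hdim (P i) (L j) = (i == j) :> nat.
Proof.
have [sL uL _] := Lrep; rewrite (hdim_cover_simple fcC (sL i) (Pcov i) (sL j)).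
by congr nat_of_bool; apply/asboolP/eqP => [/uL//|->]; exact: isomorphic_refl.
Qed.

Lemma nonzero_hdim X : ~ is_zero X -> exists i, (0 < hdim (P i) X)%N.
Proof.
have [sL _ cL] := Lrep.
move=> /(simple_sub fcC)[S [i [sS mi]]]; have [j Sj] := cL _ sS.
exists j; apply: leq_trans (hdim_mono fcC (P j) mi).1.
by rewrite (hdim_isor fcC _ Sj) hdim_representative eqxx.
Qed.

Lemma hdim_additive Q : projective Q -> additive_on (fun X => (hdim Q X)%:R : R).
Proof. by move=> prQ X Y Z i q ses; rewrite (hdim_ses fcC prQ ses) natrD. Qed.

Lemma additive_comp (D : kcat k) (F : kfunctor C D) (phi : D -> R) :
  exact_functor F -> additive_on phi -> additive_on (fun X => phi (F X)).
Proof. by move=> exF add X Y Z i q /exF/add. Qed.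

Definition weight (v : 'I_n -> R) X := \sum_j v j *+ hdim (P j) X.

Lemma weight_additive v : additive_on (weight v).
Proof.
move=> X Y Z i q ses; rewrite /weight -big_split; apply: eq_bigr => j _ /=.
by rewrite (hdim_ses fcC (Pcov j).1 ses) mulrnDr.
Qed.

Lemma weight_representative v i : weight v (L i) = v i.
Proof.
rewrite /weight (bigD1 i) //= hdim_representative eqxx mulr1n big1 ?addr0 // => j ji.
by rewrite hdim_representative (negPf ji) mulr0n.
Qed.

Lemma additive_ext (phi psi : C -> R) : additive_on phi -> additive_on psi ->
  (forall i, phi (L i) = psi (L i)) -> forall X, phi X = psi X.
Proof.
move=> aphi apsi e X; rewrite (additiveE fcC aphi Lrep Pcov) (additiveE fcC apsi Lrep Pcov).
by apply: eq_bigr => i _; rewrite e.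
Qed.

Lemma additive_scale (c : R) (phi : C -> R) : additive_on phi ->
  additive_on (fun X => c * phi X).
Proof. by move=> a X Y Z i q /a ->; rewrite mulrDr. Qed.

Lemma additive_sum (I : finType) (phi : I -> C -> R) :
  (forall i, additive_on (phi i)) -> additive_on (fun X => \sum_i phi i X).
Proof.
move=> a X Y Z i q ses; rewrite -big_split; apply: eq_bigr => l _ /=.
exact: a ses.
Qed.

Lemma additive_ge0 (phi : C -> R) : additive_on phi -> (forall i, 0 <= phi (L i)) ->
  forall X, 0 <= phi X.
Proof.
move=> a p X; rewrite (additiveE fcC a Lrep Pcov).
by apply: sumr_ge0 => i _; rewrite mulrn_wge0.
Qed.

Lemma additive_gt0 (phi : C -> R) : additive_on phi -> (forall i, 0 < phi (L i)) ->
  forall X, ~ is_zero X -> 0 < phi X.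
Proof.
move=> a p X /nonzero_hdim[i hi]; rewrite (additiveE fcC a Lrep Pcov) (bigD1 i) //=.
apply: ltr_wpDr; first by apply: sumr_ge0 => j _; rewrite mulrn_wge0 // ltW.
by rewrite pmulrn_lgt0.
Qed.

Lemma mult_matrixE X i j :
  multiplication_matrix R L X i j = (hdim (P j) (X \ox L i))%:R.
Proof.
have [sL _ _] := Lrep.
by rewrite mxE (multiplicityE fcC (sL j) (Pcov j)).
Qed.

Lemma mult_matrix_additive (phi : C -> R) X i : additive_on phi ->
  \sum_j multiplication_matrix R L X i j * phi (L j) = phi (X \ox L i).
Proof.
move=> a; rewrite (additiveE fcC a Lrep Pcov (X \ox L i)); apply: eq_bigr => j _.
by rewrite mult_matrixE mulr_natl.
Qed.

Lemma unit_representative : exists i, isomorphic (unitob C) (L i).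
Proof.
have [_ _ cL] := Lrep; apply: cL.
exact: (unit_simple rC abC fcC (ft_end_unit C)).
Qed.

(* Applied to [FPdim \o F], this shows that F preserves dimensions. *)
Lemma FPdim_unique (phi : C -> R) X (c : R) : additive_on phi ->
  (forall i, 0 < phi (L i)) -> (forall i, phi (X \ox L i) = c * phi (L i)) ->
  FPdim_obj R L X = c.
Proof.
move=> a p e; have [i0 _] := unit_representative; set N := multiplication_matrix R L X.
have N_ge0 i j : 0 <= N i j by rewrite /N mult_matrixE.
have NE i : \sum_j N i j * phi (L j) = c * phi (L i) by rewrite mult_matrix_additive.
have cmax := positive_eigenvalue_max N_ge0 p NE.
have ceig := positive_eigenvalue i0 p NE.
rewrite /FPdim_obj; case: xgetP => [d _ [d0 dE dmax]|none].
  by apply/le_anti; rewrite cmax // dmax.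
(* Here [FPdim_obj] takes its default value 0. A positive [c] would be a largest positive
   eigenvalue, and [c] is nonnegative, so [c = 0]. *)
apply/eqP; rewrite eq_le (positive_eigenvalue_ge0 i0 N_ge0 p NE) /=.
by rewrite leNgt; apply/negP => c0; case: (none c).
Qed.

(* Right multiplication by the sum of the simple objects is a strictly positive
   matrix which commutes with all left multiplications, so its Perron vector is
   a common eigenvector of the latter. *)
Lemma FPdim_weight : exists phi : C -> R, [/\ additive_on phi,
  forall i, 0 < phi (L i) & forall X Y, phi (X \ox Y) = FPdim_obj R L X * phi Y].
Proof.
have [sL _ _] := Lrep.
pose M i j : R := \sum_l (hdim (P j) (L i \ox L l))%:R.
have M_gt0 i j : 0 < M i j.
  (* [L j] embeds into some [L i \ox Z]; as [hdim (P j) (L i \ox -)] is additive, it is already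
     nonzero on some simple [L l]. *)
  have [Z [f mf]] := tens_cogenerates rC abC fcC (ft_end_unit C) (L j) (sL i).1.
  have hZ : (0 < hdim (P j) (L i \ox Z))%N.
    apply: leq_trans (hdim_mono fcC (P j) mf).1.
    by rewrite hdim_representative eqxx.
  have h_add : additive_on (fun Y => (hdim (P j) (L i \ox Y))%:R : R).
    exact: (additive_comp (tensL_exact rC (L i)) (hdim_additive (Pcov j).1)).
  rewrite lt_def sumr_ge0 // andbT; apply/eqP => /eqP; rewrite psumr_eq0 // => /allP M0.
  move: hZ; rewrite -(ltr_nat R) (additiveE fcC h_add Lrep Pcov) big1 ?ltxx // => l _.
  by rewrite (eqP (M0 l (mem_index_enum l))) mul0rn.
have [i0 _] := unit_representative.
have [r [v [r0 v0 vE vU]]] := perron_ord i0 M_gt0.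
pose phi := weight v.
have phi_add : additive_on phi by exact: weight_additive.
have phiL i : phi (L i) = v i by exact: weight_representative.
have right_add X : additive_on (fun Y => phi (X \ox Y)).
  exact: (additive_comp (tensL_exact rC X) phi_add).
have left_add Y : additive_on (fun X => phi (X \ox Y)).
  exact: (additive_comp (tensR_exact rC Y) phi_add).
have ME (psi : C -> R) i : additive_on psi ->
    \sum_j M i j * psi (L j) = \sum_l psi (L i \ox L l).
  move=> a; under eq_bigr do rewrite mulr_suml.
  rewrite exchange_big; apply: eq_bigr => l _ /=.
  rewrite (additiveE fcC a Lrep Pcov (L i \ox L l)); apply: eq_bigr => j _.
  by rewrite mulr_natl.
have right_mul X : \sum_l phi (X \ox L l) = r * phi X.
  apply: (@additive_ext (fun X => \sum_l phi (X \ox L l)) (fun X => r * phi X)).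
    exact: additive_sum.
    exact: additive_scale.
  move=> i; rewrite -ME // phiL -vE.
  by apply: eq_bigr => j _; rewrite phiL.
(* By associativity the values [phi (X \ox L i)] form another eigenvector of [M] for [r], and that
   eigenspace is a line. *)
have scalar X : exists c, forall i, phi (X \ox L i) = c * phi (L i).
  have [|c cE] := vU (fun i => phi (X \ox L i)).
    move=> i; rewrite (ME (fun Y => phi (X \ox Y))) // -right_mul.
    apply: eq_bigr => l _; apply: (additive_iso fcC phi_add).
    by apply: isomorphic_sym; exists (assoc X (L i) (L l)); exact: assoc_iso.
  by exists c => i; rewrite cE phiL.
exists phi; split=> // [i|X Y]; first by rewrite phiL.
apply: (@additive_ext (fun Y => phi (X \ox Y)) (fun Y => FPdim_obj R L X * phi Y)) => //.
  exact: additive_scale.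
have [c cE] := scalar X; move=> i; rewrite cE; congr (_ * _).
by apply/esym; apply: (FPdim_unique phi_add) => // j; rewrite phiL.
Qed.

(** Since [X \ox unitob C] is isomorphic to [X], this [phi] is the dimension up to the factor
    [phi (unitob C)]. The properties of the dimension are read off from it by cancelling that
    factor. *)
Lemma FPdim_proportional : exists phi : C -> R, [/\ additive_on phi,
  forall X, ~ is_zero X -> 0 < phi X, phi (unitob C) != 0 &
  forall X Y, phi (X \ox Y) = FPdim_obj R L X * phi Y].
Proof.
have [phi [a p m]] := FPdim_weight; have pos := additive_gt0 a p.
exists phi; split=> //; rewrite gt_eqF //; apply: pos.
exact: unit_nonzero (ft_end_unit C).
Qed.

Lemma FPdim_additive : additive_on (FPdim_obj R L).
Proof.
have [phi [a p u m]] := FPdim_proportional => X Y Z i q ses.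
apply: (mulIf u); rewrite mulrDl -!m.
exact: (additive_comp (tensR_exact rC (unitob C)) a ses).
Qed.

Lemma FPdim_gt0 X : ~ is_zero X -> 0 < FPdim_obj R L X.
Proof.
have [phi [a p u m]] := FPdim_proportional => nzX.
have u0 : 0 < phi (unitob C) by apply: p; exact: unit_nonzero (ft_end_unit C).
rewrite -(pmulr_lgt0 _ u0) -m -(additive_iso fcC a (X := X)) ?p //.
by apply: isomorphic_sym; exists (runit X); exact: runit_iso.
Qed.

Lemma FPdim_tens X Y : FPdim_obj R L (X \ox Y) = FPdim_obj R L X * FPdim_obj R L Y.
Proof.
have [phi [a p u m]] := FPdim_proportional.
apply: (mulIf u); rewrite -mulrA -!m; apply: (additive_iso fcC a).
by exists (assoc X Y (unitob C)); exact: assoc_iso.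
Qed.

End FPdimension.

(** * The theorem *)

Section Horseshoe.
Variables (k : fieldType) (C : kcat k).

(** Half of the horseshoe lemma: [e] covers the subobject and [t] the quotient. It builds covers by
    induction along composition series. *)
Lemma horseshoe_epi (A B Z X Y S : C) (i1 : hom A Z) (i2 : hom B Z) (p1 : hom Z A)
  (p2 : hom Z B) (i : hom Y X) (q : hom X S) (t : hom A X) (e : hom B Y) :
  [/\ p1 \oc i1 = idm A, p2 \oc i2 = idm B, p1 \oc i2 = 0 & p2 \oc i1 = 0] ->
  short_exact i q -> epi (q \oc t) -> epi e -> epi (t \oc p1 + i \oc e \oc p2).
Proof.
move=> [h11 h22 h12 h21] ses eqt ee; apply/epi0P => T u u0.
have ui0 : u \oc i = 0.
  apply: ee; have := congr1 (fun f : hom Z T => f \oc i2) u0.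
  rewrite /= comp0m -compA compDl -!compA h12 h22 !compm0 add0r compm1.
  by rewrite comp0m.
have [s sq] := cokernel_desc ses.2 ui0.
suff s0 : s = 0 by rewrite -sq s0 comp0m.
apply: eqt; have := congr1 (fun f : hom Z T => f \oc i1) u0.
rewrite /= comp0m -compA compDl -!compA h11 h21 !compm0 addr0 compm1 => ut0.
by rewrite comp0m compA sq.
Qed.

End Horseshoe.

Section SplitProjective.
Variables (k : closedFieldType) (C : kcat k) (G : C) (fcC : fincat G).
Variables (n : nat) (L P : 'I_n -> C) (Lrep : simple_representatives L)
  (Pcov : forall i, projective_cover (P i) (L i)).
Variables (R : pzRingType) (phi : C -> R) (phi_add : additive_on phi).
Let abC : abelian C := fcC.

(* A nonzero projective maps onto some [L j], hence splits off [P j]. *)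
Lemma additive_projective Q : projective Q ->
  phi Q = \sum_j phi (P j) *+ hdim Q (L j).
Proof.
have [sL uL cL] := Lrep.
have [m] := ubnP (len G Q); elim: m Q => // m IH Q leQ prQ.
have [zQ|nzQ] := pselect (is_zero Q).
  rewrite (additive_zero fcC phi_add zQ) big1 // => j _.
  by rewrite (hdim0 fcC) // => f; exact: zQ.1.
have [S [q0 [sS eq0]]] := simple_quotient fcC nzQ.
have [j [a ia]] := cL _ sS; pose q := a \oc q0.
have eq : epi q by apply: epi_comp => //; exact: iso_epi.
have [prP [e [ee ess]]] := Pcov j.
have [g gE] := prQ _ _ e q ee.
have eg : epi g by apply: ess; rewrite gE.
have [s gs] := prP _ _ g (idm _) eg.
have [K [i ses]] := epi_ses abC eg.
have gi0 := ses.1.1; have mi := kernel_mono ses.1.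
have [r ir] : exists r, i \oc r = idm Q - s \oc g.
  by apply: (kernel_lift ses.1); rewrite compBr compm1 compA gs comp1m subrr.
have ri : r \oc i = idm K.
  by apply: mi; rewrite compA ir compBl -compA gi0 compm0 subr0 comp1m compm1.
have prK := projective_retract ri prQ.
have lP : (0 < len G (P j))%N.
  by apply: (len_gt0 fcC) => zP; apply: (sL j).1; exact: zero_quotient ee zP.
have lQ := len_ses fcC ses.
have hQ T : hdim Q T = (hdim (P j) T + hdim K T)%N.
  apply: has_dim_uniq (hdimP fcC Q T) _.
  apply: (has_dim_exact (i := fun u : hom (P j) T => u \oc g)
                        (p := fun v : hom Q T => v \oc i)); try exact: (hdimP fcC).
  - by move=> c u v; rewrite comp_linl.
  - by move=> c u v; rewrite comp_linl.
  - by move=> u v; exact: eg.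
  - by move=> w; exists (w \oc r); rewrite -compA ri compm1.
  - by move=> u; rewrite -compA gi0 compm0.
  - by move=> v; exact: (cokernel_desc ses.2).
rewrite (phi_add ses) (IH K) //; last by lia.
under [RHS]eq_bigr => l _ do rewrite hQ mulrnDr.
rewrite big_split /= addrC; congr (_ + _).
rewrite (bigD1 j) //= big1 ?addr0 => [|l lj].
  by rewrite (hdim_cover_self fcC (sL j) (Pcov j)).
rewrite (hdim_cover_simple fcC (sL j) (Pcov j) (sL l)).
by case: asboolP => // /uL lj'; rewrite lj' eqxx in lj.
Qed.

End SplitProjective.

Section StableSurjective.
Variables (k : fieldType) (C D : kcat k) (abC : abelian C) (abD : abelian D).
Variables (F : kfunctor C D) (projF : preserves_projectives F).

(* If every map [F X -> Y] vanished, the identity of [Y] would be stably zero. *)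
Lemma stable_ess_surj_hom (Y : D) : equivalence (stable_functor abC abD projF) ->
  ~ projective Y -> exists X (f : hom (F X) Y), f <> 0.
Proof.
move=> eqF npY; apply: contrapT => none; apply: npY.
have [X [u [v [_ uv]]]] := equivalence_ess_surj eqF Y.
have [f fE] := stable_class_surj (u : stable_hom abD (F X) Y).
have [g gE] := stable_class_surj (v : stable_hom abD Y (F X)).
have f0 : f = 0 by apply: contrapT => f0; apply: none; exists X, f.
have : stable_class abD (f \oc g) = stable_class abD (idm Y).
  by rewrite -stable_compE -fE -gE; exact: uv.
move=> /stable_classP; rewrite f0 comp0m sub0r => -[Q [a [b [prQ ab]]]].
(* What factors through [Q] is [0 - idm Y], hence the sign. *)
apply: (projective_retract (i := a) (p := - b)) prQ.
by rewrite -scaleN1r compZl -ab scaleN1r opprK.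
Qed.

End StableSurjective.

(** Representatives and covers exist, so the [xget] in [FPdim] does not fall back on its default;
    the data it picked are used from here on. *)
Lemma FPdim_witness (R : realType) (k : closedFieldType) (C : ftcat k) :
  exists n (L P : 'I_n -> C),
  [/\ simple_representatives L, forall i, projective_cover (P i) (L i)
    & FPdim R C = \sum_i FPdim_obj R L (L i) * FPdim_obj R L (P i)].
Proof.
rewrite /FPdim; case: xgetP => [d _ //|none].
have [G fcC] := finite_fincat (ft_finite C).
have [n [L Lrep]] := simple_representatives_exist fcC; have [sL _ _] := Lrep.
have [P Pcov] := choice (fun i => projective_cover_exists fcC (sL i)).
by case: (none (\sum_i FPdim_obj R L (L i) * FPdim_obj R L (P i))); exists n, L, P.
Qed.

(** * Comparison of dimensions, fullness and essential surjectivity *)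

Section Main.
Variables (k : closedFieldType) (R : realType) (C D : ftcat k).
Variables (F : monfunctor C D).
Hypotheses (exF : exact_functor F) (prF : preserves_projectives F).
Variables (G : C) (fcC : fincat G) (H : D) (fcD : fincat H).
Variables (n : nat) (L P : 'I_n -> C) (n' : nat) (L' P' : 'I_n' -> D).
Hypotheses (Lrep : simple_representatives L)
  (Pcov : forall i, projective_cover (P i) (L i)).
Hypotheses (L'rep : simple_representatives L')
  (P'cov : forall i, projective_cover (P' i) (L' i)).
Hypothesis homF : forall j, exists X (f : hom (F X) (L' j)), f <> 0.
Hypothesis eq_dim : \sum_i FPdim_obj R L (L i) * FPdim_obj R L (P i) =
  \sum_j FPdim_obj R L' (L' j) * FPdim_obj R L' (P' j).
Let abC : abelian C := fcC.
Let abD : abelian D := fcD.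

Let F_zero X : is_zero (F X) -> is_zero X.
Proof.
exact: (exact_monoidal_zero abC (@ft_rigid k C) exF fcC (ft_end_unit C)
  (unit_nonzero (ft_end_unit D))).
Qed.

Let F_faithful : faithful F.
Proof. exact: exact_faithful abC exF F_zero. Qed.

Let d := FPdim_obj R L.
Let d' := FPdim_obj R L'.

Let d_add : additive_on d := FPdim_additive R fcC Lrep Pcov.
Let d'_add : additive_on d' := FPdim_additive R fcD L'rep P'cov.
Let d'_gt0 Y : ~ is_zero Y -> 0 < d' Y := @FPdim_gt0 R k D H fcD n' L' P' L'rep P'cov Y.

Lemma FPdim_image X : d' (F X) = d X.
Proof.
have [sL _ _] := Lrep.
have add : additive_on (fun X => d' (F X)) by exact: additive_comp exF d'_add.
apply/esym/(FPdim_unique fcC Lrep Pcov add) => i.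
  by apply: d'_gt0 => /F_zero; exact: (sL i).1.
rewrite /d' -(FPdim_tens R fcD L'rep P'cov).
apply/esym/(additive_iso fcD d'_add).
by exists (mon_tens F X (L i)); exact: mon_tens_iso.
Qed.

Let coef j : R := \sum_i d (L i) *+ hdim (F (P i)) (L' j).

Lemma coef_sum : \sum_i d (L i) * d (P i) = \sum_j coef j * d' (P' j).
Proof.
transitivity (\sum_i d (L i) * \sum_j d' (P' j) *+ hdim (F (P i)) (L' j)).
  apply: eq_bigr => i _; rewrite -[d (P i)]FPdim_image.
  by rewrite (additive_projective fcD L'rep P'cov d'_add (prF (Pcov i).1)).
under eq_bigr do rewrite mulr_sumr.
rewrite exchange_big; apply: eq_bigr => j _ /=; rewrite /coef mulr_suml.
by apply: eq_bigr => i _; rewrite mulrnAr mulrnAl.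
Qed.

(* [X] is chosen of minimal length, so that [g |-> f (F g)] is injective on
   [Hom (P i, X)]: otherwise [f] would factor through [F] of a proper quotient. *)
Lemma minimal_preimage j : exists X (f : hom (F X) (L' j)), f <> 0 /\
  forall T (g : hom T X), f \oc fmap F g = 0 -> g = 0.
Proof.
pose A l := `[< exists X (f : hom (F X) (L' j)), f <> 0 /\ len G X = l >].
have [X0 [f0 f0n]] := homF j.
have exA : exists l, A l by exists (len G X0); apply/asboolP; exists X0, f0.
have [l /asboolP[X [f [fn lX]]] lmin] := ex_minnP exA.
exists X, f; split=> // T g fg0; apply: contrapT => g0.
have [I [p [m [ep mm gE]]]] := image abC g.
have fm0 : f \oc fmap F m = 0.
  by apply: (fmap_epi abC exF ep); rewrite comp0m -compA -fmapM -gE.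
have [Q [c ses]] := mono_ses abC mm.
have [s sc] := cokernel_desc (exF ses).2 fm0.
have AQ : A (len G Q).
  by apply/asboolP; exists Q, s; split=> // s0; apply: fn; rewrite -sc s0 comp0m.
have lI : (0 < len G I)%N.
  by apply: (len_gt0 fcC) => -[zI _]; apply: g0; rewrite gE (zI _ m) comp0m.
by have := lmin _ AQ; rewrite -lX (len_ses fcC ses); lia.
Qed.

Lemma hdim_transfer j X (f : hom (F X) (L' j)) i :
  (forall T (g : hom T X), f \oc fmap F g = 0 -> g = 0) ->
  (hdim (P i) X <= hdim (F (P i)) (L' j))%N /\
  (hdim (P i) X = hdim (F (P i)) (L' j) ->
    forall h : hom (F (P i)) (L' j), exists g, f \oc fmap F g = h).
Proof.
move=> finj.
have lin : linear (fun g : hom (P i) X => f \oc fmap F g).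
  by move=> a u v; rewrite fmap_lin comp_linr.
by apply: (has_dim_inj (hdimP fcC _ _) (hdimP fcD _ _) lin); apply: linear_inj => // g /finj.
Qed.

Lemma coef_ge j X (f : hom (F X) (L' j)) : f <> 0 ->
  (forall T (g : hom T X), f \oc fmap F g = 0 -> g = 0) ->
  d' (L' j) <= d' (F X) <= coef j.
Proof.
move=> f0 finj; have [sL' _ _] := L'rep.
have [K [i ses]] := epi_ses abD (to_simple_epi abD (sL' j) f0).
have [sL _ _] := Lrep.
rewrite (d'_add ses) lerDr; apply/andP; split.
  apply: (additive_ge0 fcD L'rep P'cov d'_add) => l; apply: ltW.
  exact: d'_gt0 (sL' l).1.
rewrite -(d'_add ses) FPdim_image (additiveE fcC d_add Lrep Pcov X).
apply: ler_sum => l _; apply: ler_wpMn2l; last exact: (hdim_transfer l finj).1.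
by apply/ltW/(FPdim_gt0 R fcC Lrep Pcov)/(sL l).1.
Qed.

Lemma coefE j : coef j = d' (L' j).
Proof.
have ge l : 0 <= (coef l - d' (L' l)) * d' (P' l).
  have [X [f [f0 finj]]] := minimal_preimage l.
  have /andP[h1 h2] := coef_ge f0 finj.
  have [sL' _ _] := L'rep; have [prP [e [ee _]]] := P'cov l.
  rewrite mulr_ge0 ?subr_ge0 ?(le_trans h1) //; apply/ltW/d'_gt0 => zP.
  exact: (sL' l).1 (zero_quotient ee zP).
have sum0 : \sum_l (coef l - d' (L' l)) * d' (P' l) = 0.
  under eq_bigr do rewrite mulrBl.
  by rewrite sumrB -coef_sum -eq_dim subrr.
move/eqP: sum0; rewrite psumr_eq0 // => /allP/(_ j (mem_index_enum j)).
rewrite mulf_eq0 subr_eq0 => /orP[/eqP //|/eqP dP0].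
have [sL' _ _] := L'rep; have [prP [e [ee _]]] := P'cov j.
suff : 0 < d' (P' j) by rewrite dP0 ltxx.
by apply: d'_gt0 => zP; exact: (sL' j).1 (zero_quotient ee zP).
Qed.

Lemma simple_preimage j : exists X (f : hom (F X) (L' j)), is_iso f /\
  forall i (h : hom (F (P i)) (L' j)), exists g, f \oc fmap F g = h.
Proof.
have [X [f [f0 finj]]] := minimal_preimage j.
have [sL _ _] := Lrep; have [sL' _ _] := L'rep.
have := coef_ge f0 finj; rewrite coefE => dFX.
have {}dFX : d' (F X) = d' (L' j) by apply/esym/le_anti.
have ef := to_simple_epi abD (sL' j) f0.
exists X, f; split.
  apply: contrapT => nif; have [K [i ses]] := epi_ses abD ef.
  have nzK : ~ is_zero K.
    move=> [zK _]; apply: nif; apply: (mono_epi_iso abD _ ef); apply/mono0P => T u fu0.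
    by have [s <-] := kernel_lift ses.1 fu0; rewrite (zK _ i) comp0m.
  by have := d'_gt0 nzK; have := d'_add ses; rewrite dFX; lra.
move=> i; apply: (hdim_transfer i finj).2.
(* The weights [d (L l)] are positive and the differences nonnegative, so each difference vanishes
   and the equality clause of [hdim_transfer] applies. *)
have : \sum_l d (L l) *+ (hdim (F (P l)) (L' j) - hdim (P l) X) = 0.
  under eq_bigr => l _ do rewrite mulrnBr ?(hdim_transfer l finj).1 //.
  rewrite sumrB -(additiveE fcC d_add Lrep Pcov X) -FPdim_image dFX.
  by rewrite -coefE subrr.
have dpos l : 0 < d (L l) by apply: (FPdim_gt0 R fcC Lrep Pcov); exact: (sL l).1.
move/eqP; rewrite psumr_eq0 => [|l _]; last by rewrite mulrn_wge0 // ltW.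
move=> /allP/(_ i (mem_index_enum i)) /=; rewrite mulrn_eq0 (gt_eqF (dpos i)) orbF.
by rewrite subn_eq0 => le; apply/eqP; rewrite eqn_leq le (hdim_transfer i finj).1.
Qed.

Lemma reflects_simple X : simple (F X) -> simple X.
Proof.
move=> [nz sFX]; split=> [zX|T m mm]; first exact: nz (fob_zero F zX).
have [/F_zero zT|/iso_epi eFm] := sFX _ _ (fmap_mono abC exF mm); first by left.
right; apply: (mono_epi_iso abC mm).
exact: faithful_reflects_epi F_faithful eFm.
Qed.

(** [simple_preimage] lifts maps only into the objects [X] it produces, so [S], isomorphic to [L l],
    must be identified with one of them. For a simple quotient [L' j] of [F (L l)], the epimorphism
    from [F (P l)] to [L' j] lifts to a nonzero map from [P l] to [X], and a cover has only one
    simple quotient. *)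
Lemma full_simple i S (h : hom (F (P i)) (F S)) : simple S ->
  exists g, fmap F g = h.
Proof.
have [sL _ cL] := Lrep; have [sL' _ cL'] := L'rep => sS.
have [l [b ib]] := cL _ sS.
have [T [q0 [sT eq0]]] : exists T (q : hom (F (L l)) T), simple T /\ epi q.
  by apply: (simple_quotient fcD) => /F_zero; exact: (sL l).1.
have [j [c ic]] := cL' _ sT; pose q := c \oc q0.
have eq : epi q by apply: epi_comp => //; exact: iso_epi.
have [X [f [[f' [f'f ff']] flift]]] := simple_preimage j.
have sX : simple X.
  by apply: reflects_simple; apply: simple_iso (sL' j); exists f'; exists f.
have [prP [e [ee _]]] := Pcov l.
have [g gE] := flift l (q \oc fmap F e).
have g0 : g <> 0.
  move=> g0; apply: (sL' j).1; apply: (epi_zero (epi_comp eq (fmap_epi abC exF ee))).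
  by rewrite -gE g0 fmap0 compm0.
have [a [a' [a'a aa']]] : isomorphic S X.
  apply: (isomorphic_trans (ex_intro _ b ib)); apply: isomorphic_sym.
  exact: (cover_simple_hom fcC (sL l) (Pcov l) sX g0).
have [u uE] := flift i (f \oc fmap F a \oc h).
exists (a' \oc u); rewrite fmapM -[fmap F u]comp1m -f'f -compA uE.
by rewrite !compA -(compA (fmap F a')) f'f compm1 -fmapM a'a fmap1 comp1m.
Qed.

Definition full_on X := forall Y (h : hom (F X) (F Y)), exists g, fmap F g = h.

(** A preimage of [fmap F q \oc h] lifts along [q] because [P i] is projective; the remaining
    difference takes values in [F] of the kernel, where induction applies. *)
Lemma full_on_cover i : full_on (P i).
Proof.
move=> Y; elim/(length_ind fcC): Y => [Y zY h|Y Y1 S j q ses sS IH h].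
  by exists 0; rewrite fmap0 ((fob_zero F zY).2 _ h).
have [g0 g0E] := full_simple (fmap F q \oc h) sS.
have [g1 g1E] := (Pcov i).1 _ _ q g0 (cokernel_epi ses.2).
have [h1 h1E] : exists h1, fmap F j \oc h1 = h - fmap F g1.
  apply: (kernel_lift (exF ses).1).
  by rewrite compBr -fmapM g1E g0E subrr.
have [g2 g2E] := IH h1; exists (j \oc g2 + g1).
by rewrite -[_ \oc g2]scale1r fmap_lin scale1r fmapM g2E h1E subrK.
Qed.

Lemma full_on_biproduct X Y Z : is_biproduct X Y Z ->
  full_on X -> full_on Y -> full_on Z.
Proof.
move=> [i1 [i2 [p1 [p2 [_ _ _ _ dec]]]]] fX fY T h.
have [g1 g1E] := fX _ (h \oc fmap F i1); have [g2 g2E] := fY _ (h \oc fmap F i2).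
exists (g1 \oc p1 + g2 \oc p2).
rewrite -[g1 \oc p1]scale1r fmap_lin scale1r !fmapM g1E g2E.
rewrite -!compA -!fmapM -compDr -[fmap F (i1 \oc p1)]scale1r -fmap_lin scale1r.
by rewrite dec fmap1 compm1.
Qed.

Lemma full_on_epi X : exists Q (e : hom Q X), epi e /\ full_on Q.
Proof.
have [sL _ cL] := Lrep.
elim/(length_ind fcC): X => [X zX|X Y S i q ses sS [Q [e [ee fQ]]]].
  exists X, (idm X); split; first exact/iso_epi/iso_id.
  by move=> Y h; exists 0; rewrite fmap0 ((fob_zero F zX).1 _ h).
have [l Sl] := cL _ sS; have [b ib] := isomorphic_sym Sl.
have [prP [c [ec _]]] := Pcov l.
have [t tE] := prP _ _ q (b \oc c) (cokernel_epi ses.2).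
have [Z biZ] := ab_biproduct abC (P l) Q.
have [i1 [i2 [p1 [p2 [h1 h2 h3 h4 _]]]]] := biZ.
exists Z, (t \oc p1 + i \oc e \oc p2); split.
  apply: (horseshoe_epi (And4 h1 h2 h3 h4) ses) => //.
  by rewrite tE; apply: epi_comp => //; exact: iso_epi.
exact: full_on_biproduct biZ (@full_on_cover l) fQ.
Qed.

(** A map out of [F X] pulls back to [F Q], where it comes from [C]; faithfulness shows that its
    lift still kills the kernel of [e]. *)
Lemma F_full : full F.
Proof.
move=> X Y h; have [Q [e [ee fQ]]] := full_on_epi X.
have [g gE] := fQ _ (h \oc fmap F e).
have [K [i ses]] := epi_ses abC ee.
have gi0 : g \oc i = 0.
  apply: F_faithful; rewrite fmapM gE -compA -fmapM.
  by rewrite ses.1.1 fmap0 compm0.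
have [s sE] := cokernel_desc ses.2 gi0; exists s.
by apply: (fmap_epi abC exF ee); rewrite -fmapM sE.
Qed.

(** With [Q1] the cover of a preimage of the simple quotient [S], the object [F Q1] is projective,
    so its map onto [S] lifts to [Y]. *)
Lemma image_generates Y : exists Q (e : hom (F Q) Y), epi e.
Proof.
have [sL' _ cL'] := L'rep.
elim/(length_ind fcD): Y => [Y zY|Y Y1 S i q ses sS [Q [e ee]]].
  exists G, 0; apply/epi0P => T u _; exact: zY.1.
have [j Sj] := cL' _ sS; have [b ib] := isomorphic_sym Sj.
have [X [f [[f' [f'f ff']] _]]] := simple_preimage j.
have sX : simple X.
  by apply: reflects_simple; apply: simple_iso (sL' j); exists f'; exists f.
have [Q1 [prQ1 [c [ec _]]]] := projective_cover_exists fcC sX.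
have [t tE] := prF prQ1 (b \oc f \oc fmap F c) (cokernel_epi ses.2).
have [Z [i1 [i2 [p1 [p2 [h1 h2 h3 h4 _]]]]]] := ab_biproduct abC Q1 Q.
exists Z, (t \oc fmap F p1 + i \oc e \oc fmap F p2).
apply: (@horseshoe_epi _ _ _ _ _ _ _ _ (fmap F i1) (fmap F i2)) ses _ ee.
  by rewrite -!fmapM h1 h2 h3 h4 !fmap1 !fmap0.
rewrite tE; apply: epi_comp; last exact: fmap_epi abC exF ec.
by apply: epi_comp; [exact: iso_epi ib | apply: iso_epi; exists f'].
Qed.

Lemma F_ess_surj : ess_surj F.
Proof.
move=> Y; have [Q0 [e0 ee0]] := image_generates Y.
have [K [i ses]] := epi_ses abD ee0; have [Q1 [e1 ee1]] := image_generates K.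
have [h hE] := F_full (i \oc e1).
(* [exact_functor] speaks of short exact sequences, so the cokernel [X] of [h] is taken as the
   cokernel of its image. *)
have [I [p [m [ep mm hmp]]]] := image abC h.
have [X [c cses]] := mono_ses abC mm.
have Fses := exF cses.
have e0m : e0 \oc fmap F m = 0.
  apply: (fmap_epi abC exF ep); rewrite -compA -fmapM -hmp hE compA ses.1.1.
  by rewrite !comp0m.
have [s sE] := cokernel_desc Fses.2 e0m.
have ci0 : fmap F c \oc i = 0.
  apply: ee1; rewrite -compA -hE hmp -fmapM compA cses.1.1 comp0m fmap0.
  by rewrite comp0m.
have [t tE] := cokernel_desc ses.2 ci0.
exists X; exists s; exists t; split.
  by apply: (cokernel_epi Fses.2); rewrite -compA sE tE comp1m.
by apply: ee0; rewrite -compA tE sE comp1m.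
Qed.

Lemma F_equivalence : equivalence F.
Proof. exact: equivalenceI F_faithful F_full F_ess_surj. Qed.

End Main.

Theorem theorem1p2 (k : closedFieldType) (R : realType) (C C' : ftcat k)
  (nonsemisimple_C : ~ semisimple C)
  (nonsemisimple_C' : ~ semisimple C')
  (no_projective_simple_C : forall S : C, simple S -> ~ projective S)
  (no_projective_simple_C' : forall S : C', simple S -> ~ projective S)
  (eq_FPdim : FPdim R C = FPdim R C')
  (F : monfunctor C C')
  (exact_F : exact_functor F)
  (stable_equivalence_F : induces_stable_equivalence F) :
  tensor_equivalence F.
Proof.
have [projF eqF] := stable_equivalence_F.
have [G fcC] := finite_fincat (ft_finite C).
have [G' fcC'] := finite_fincat (ft_finite C').
have [n [L [P [Lrep Pcov dimC]]]] := FPdim_witness R C.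
have [n' [L' [P' [L'rep P'cov dimC']]]] := FPdim_witness R C'.
apply: (F_equivalence exact_F projF fcC fcC' Lrep Pcov L'rep P'cov (R := R)).
  move=> j; apply: stable_ess_surj_hom eqF _.
  by have [sL' _ _] := L'rep; exact: no_projective_simple_C' (sL' j).
by rewrite -dimC -dimC'.
Qed.
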